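(* Let $T>0$ be such that none of the numbers $k\pi/T$, $k=1,2,\dots$, is an eigenvalue of $A$. Let $f,g\in\mathcal{H}^1(\Omega)$ and let $\varphi_0\in H$ be arbitrary. Suppose that the problem $$(\partial_t^2+A^2)u=0\ \text{ in }(0,T)\times\Omega,\qquad u(0)=f,\quad u(T)=g$$ is consistent for the data $(f,g)$, i.e. it has a solution $u\in V_h$. Define $\varphi_k:=T_h(\varphi_{k-1})$ for $k\ge1$, where $T_h:H\to H$ is the affine operator $$T_h(\varphi):=\cos(AT)^2\varphi-\cos(AT)\sin(AT)Af+\sin(AT)Ag .$$ Then the sequence $\varphi_k$ converges to $\partial_tu(0)$ in the norm of $H$.
   Context: Let $\Omega\subset\mathbb{R}^n$ be an open, bounded set with smooth boundary and let $A$ be a positive ($\langle A\varphi,\varphi\rangle>0$ for $0\neq\varphi$ in the domain of $A$), self-adjoint, unbounded operator with discrete spectrum, densely defined on the Hilbert space $H:=L^2(\Omega)$. Let $E_\lambda$, $\lambda\in\mathbb{R}$, denote the resolution of the identity associated to $A$. For $s\ge 0$ set $\mathcal{H}^s(\Omega):=\{\varphi\in H : \|\varphi\|_s:=(\int_0^\infty(1+\lambda^2)^s\,d\langle E_\lambda\varphi,\varphi\rangle)^{1/2}<\infty\}$, so $\mathcal{H}^0(\Omega)=H$. Functions of $A$ are defined by the spectral calculus of $A$. $V_h:=\{u\in C(0,T;\mathcal{H}^1(\Omega)) : \partial_tu\in C(0,T;H)\text{ and }(\partial_t^2+A^2)u=0\}$, with norm $\|u\|_{V_h}:=\sup_{t\in[0,T]}(\|u(t)\|_1^2+\|\partial_tu(t)\|_0^2)^{1/2}$;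 here $C(0,T;X)$ denotes continuous functions $[0,T]\to X$ (sup norm). For $u\in V_h$ one has $u(0),u(T)\in\mathcal{H}^1(\Omega)$ and $\partial_tu(0),\partial_tu(T)\in H$. The operator $T_h$ arises as follows: given $\varphi$, solve for $v,w\in V_h$ the problems $(\partial_t^2+A^2)v=0$, $v(0)=f$, $\partial_tv(0)=\varphi$, and (with reversed time) $(\partial_t^2+A^2)w=0$, $w(T)=g$, $\partial_tw(T)=\partial_tv(T)$; then $T_h(\varphi)=\partial_tw(0)$. *)

(* Defs.v *)
From HB Require Import structures.
From mathcomp Require Import all_boot all_order all_algebra.
From mathcomp Require Import all_classical all_reals all_analysis.
From mathcomp Require Import lra.
Set Implicit Arguments.
Unset Strict Implicit.
Unset Printing Implicit Defensive.
Import Order.TTheory GRing.Theory Num.Theory.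
Import numFieldNormedType.Exports.
Local Open Scope classical_set_scope.
Local Open Scope ring_scope.

Section lebesgue_tuple_step.
Context {R : realType} (n : nat).
Variable m : {sigma_finite_measure set (n.-tuple R) -> \bar R}.

Definition tuple_cons (p : R * n.-tuple R) : n.+1.-tuple R :=
  [tuple of p.1 :: p.2].

Lemma measurable_tuple_cons : measurable_fun [set: R * n.-tuple R] tuple_cons.
Proof.
exact: (@measurable_cons _ _ _ _ (fst : R * n.-tuple R -> R) _ snd).
Qed.

Definition lebesgue_tuple_step : set (n.+1.-tuple R) -> \bar R :=
  pushforward (lebesgue_measure \x m)%E tuple_cons.

Fact lebesgue_tuple_step0 : lebesgue_tuple_step set0 = 0%E.
Proof. by rewrite /lebesgue_tuple_step /pushforward preimage_set0 measure0. Qed.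

Fact measurable_preimage_cons (A : set (n.+1.-tuple R)) :
  measurable A -> measurable (tuple_cons @^-1` A).
Proof.
by move=> mA; rewrite -[X in measurable X]setTI; exact: measurable_tuple_cons.
Qed.

Fact lebesgue_tuple_step_ge0 A : (0 <= lebesgue_tuple_step A)%E.
Proof. by rewrite /lebesgue_tuple_step /pushforward measure_ge0. Qed.

Fact lebesgue_tuple_step_sigma_additive :
  semi_sigma_additive lebesgue_tuple_step.
Proof.
move=> F mF tF mUF; rewrite /lebesgue_tuple_step /pushforward preimage_bigcup.
apply: measure_semi_sigma_additive.
- by move=> k; exact: measurable_preimage_cons.
- apply/trivIsetP => /= i j _ _ ij; rewrite -preimage_setI.
  by move/trivIsetP : tF => /(_ _ _ _ _ ij) ->//; rewrite preimage_set0.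
- by rewrite -preimage_bigcup; exact: measurable_preimage_cons.
Qed.

HB.instance Definition _ := isMeasure.Build _ _ _ lebesgue_tuple_step
  lebesgue_tuple_step0 lebesgue_tuple_step_ge0
  lebesgue_tuple_step_sigma_additive.

Fact lebesgue_tuple_step_sigma_finite : sigma_finite setT lebesgue_tuple_step.
Proof.
have /sigma_finiteP[F [TF ndF Foo]] := sigma_finiteT (@lebesgue_measure R).
have /sigma_finiteP[G [TG ndG Goo]] := sigma_finiteT m.
pose back (t : n.+1.-tuple R) : R * n.-tuple R :=
  (thead t, [tuple of behead t]).
have mback : measurable_fun setT back.
  apply: measurable_fun_pair; last exact: measurable_behead.
  exact: (@measurable_tnth _ R n.+1 ord0).
exists (fun k => back @^-1` (F k `*` G k)).
  rewrite -preimage_bigcup -(@preimage_setT _ _ back); congr preimage.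
  rewrite -setXTT TF TG predeqE => -[x y]; split.
    move=> [/= [i _ Fx] [k _ Gy]]; exists (maxn i k) => //; split.
    - by move: x Fx; exact/subsetPset/ndF/leq_maxl.
    - by move: y Gy; exact/subsetPset/ndG/leq_maxr.
  by move=> [i _ []/= ? ?]; split; exists i.
move=> k; have [? ?] := Foo k; have [? ?] := Goo k.
have mFG : measurable (F k `*` G k) by exact: measurableX.
split; first by rewrite -[X in measurable X]setTI; exact: mback.
rewrite /lebesgue_tuple_step /pushforward -comp_preimage.
rewrite (_ : back \o tuple_cons = id) ?preimage_id.
  by rewrite product_measure1E// lte_mul_pinfty// ge0_fin_numE.
apply/funext => -[x t]; rewrite /back/= theadE; congr pair.
exact: val_inj.
Qed.

HB.instance Definition _ := @Measure_isSigmaFinite.Build _ _ _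
  lebesgue_tuple_step lebesgue_tuple_step_sigma_finite.

End lebesgue_tuple_step.

(* n-dimensional Lebesgue measure as an iterated product measure *)
Fixpoint lebesgue_tuple {R : realType} (n : nat) :
    {sigma_finite_measure set (n.-tuple R) -> \bar R} :=
  if n is k.+1 then lebesgue_tuple_step (lebesgue_tuple k)
  else (\d_([tuple] : 0.-tuple R)).

Definition borelRn (R : realType) (n : nat) :=
  g_sigma_algebraType (@open 'rV[R]_n).

Definition row_of_tuple {R : realType} n (t : n.-tuple R) : borelRn R n :=
  (\row_i tnth t i : 'rV[R]_n).


Section lebesgue_Rn.
Context {R : realType} (n : nat).

Lemma open_measurableRn (U : set 'rV[R]_n) :
  open U -> measurable (U : set (borelRn R n)).
Proof. by move=> oU; apply: sub_sigma_algebra. Qed.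

Fact measurable_preimage_ball (c : 'rV[R]_n) (e : R) :
  measurable (@row_of_tuple R n @^-1` ball c e).
Proof.
have [e0|e0] := ltP 0 e; last first.
  rewrite (_ : _ @^-1` _ = set0); first exact: measurable0.
  by rewrite -subset0 => t; rewrite /ball/= /mx_ball => -[]; rewrite ltNge e0.
rewrite (_ : _ @^-1` _ =
   \bigcap_(i in [set: 'I_n]) ((@tnth n R ^~ i) @^-1` ball (c ord0 i) e)).
  apply: fin_bigcap_measurable; first exact: finite_finset.
  move=> i _; rewrite -[X in measurable X]setTI.
  apply: (@measurable_tnth _ R n i) => //.
  by rewrite ball_itv; exact: measurable_itv.
apply/seteqP; split => [t|t].
  by move=> -[_ h] i _; have := h ord0 i; rewrite mxE.
move=> h; split=> // j i; rewrite mxE (ord1 j); exact: h.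
Qed.

Lemma measurable_row_of_tuple :
  measurable_fun [set: n.-tuple R] (@row_of_tuple R n).
Proof.
apply: (@measurability _ _ _ (borelRn R n) setT (@row_of_tuple R n)
  (@open 'rV[R]_n)) => // _ [U oU <-].
rewrite setTI.
pose c (q : 'rV[rat]_n) : 'rV[R]_n := map_mx ratr q.
pose e (k : nat) : R := k.+1%:R^-1.
pose B (p : 'rV[rat]_n * nat) : set 'rV[R]_n :=
  [set y | ball (c p.1) (e p.2) `<=` U /\ ball (c p.1) (e p.2) y].
suff UE : U = \bigcup_p B p.
  rewrite [in X in measurable X]UE preimage_bigcup.
  apply: countable_bigcupT_measurable => // p.
  have [pU|pU] := pselect (ball (c p.1) (e p.2) `<=` U).
    rewrite (_ : _ @^-1` _ = @row_of_tuple R n @^-1` ball (c p.1) (e p.2)).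
      exact: measurable_preimage_ball.
    by apply/seteqP; split => [t []|t].
  rewrite (_ : _ @^-1` _ = set0); first exact: measurable0.
  by rewrite -subset0 => t [].
apply/seteqP; split => [x Ux|x [p _ [pU /pU]]//].
have /nbhs_ballP[r /= r0 xrU] : nbhs x U by exact: open_nbhs_nbhs.
have [k kr] : exists k, 2 * e k < r.
  have /ltr_add_invr[k] : 0 < r / 2 by rewrite divr_gt0.
  by rewrite add0r => kr; exists k; rewrite mulrC -ltr_pdivlMr.
have ek : 0 < e k by rewrite invr_gt0.
have qP i : exists q : rat, `|x ord0 i - ratr q| < e k.
  have /rat_in_itvoo[q] : x ord0 i - e k < x ord0 i + e k.
    by rewrite ltrBlDr -addrA ltrDl addr_gt0.
  rewrite in_itv/= => /andP[q1 q2]; exists q.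
  by rewrite distrC ltr_distl q1.
have [q qE] := choice qP.
exists (\row_i q i, k) => //; rewrite /B/=.
have bx : ball (c (\row_i q i)) (e k) x.
  by split => // j i; rewrite !mxE (ord1 j); apply: ball_sym; exact: qE.
split => // y yq; apply: xrU.
apply: (@le_ball _ _ _ (2 * e k)); first exact: ltW.
by rewrite mulr_natl mulr2n; apply: ball_triangle (ball_sym bx) yq.
Qed.

Definition lebesgue_Rn : set (borelRn R n) -> \bar R :=
  pushforward (lebesgue_tuple n) (@row_of_tuple R n).

Fact measurable_preimage_row (A : set (borelRn R n)) :
  measurable A -> measurable (@row_of_tuple R n @^-1` A).
Proof.
by move=> mA; rewrite -[X in measurable X]setTI; exact: measurable_row_of_tuple.
Qed.

Fact lebesgue_Rn0 : lebesgue_Rn set0 = 0%E.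
Proof. by rewrite /lebesgue_Rn /pushforward preimage_set0 measure0. Qed.

Fact lebesgue_Rn_ge0 A : (0 <= lebesgue_Rn A)%E.
Proof. by rewrite /lebesgue_Rn /pushforward measure_ge0. Qed.

Fact lebesgue_Rn_sigma_additive : semi_sigma_additive lebesgue_Rn.
Proof.
move=> F mF tF mUF; rewrite /lebesgue_Rn /pushforward preimage_bigcup.
apply: measure_semi_sigma_additive.
- by move=> k; exact: measurable_preimage_row.
- apply/trivIsetP => /= i j _ _ ij; rewrite -preimage_setI.
  by move/trivIsetP : tF => /(_ _ _ _ _ ij) ->//; rewrite preimage_set0.
- by rewrite -preimage_bigcup; exact: measurable_preimage_row.
Qed.

HB.instance Definition _ := isMeasure.Build _ _ _ lebesgue_Rn
  lebesgue_Rn0 lebesgue_Rn_ge0 lebesgue_Rn_sigma_additive.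

End lebesgue_Rn.

HB.mixin Record isInnerProduct (R : realType) V & NormedModule R V := {
  inner : V -> V -> R ;
  innerC : forall x y, inner x y = inner y x ;
  innerDl : forall x y z, inner (x + y) z = inner x z + inner y z ;
  innerZl : forall a x y, inner (a *: x) y = a * inner x y ;
  inner_norm : forall x, inner x x = `|x| ^+ 2
}.

#[short(type="innerProductType")]
HB.structure Definition InnerProduct (R : realType) :=
  { V of NormedModule R V & isInnerProduct R V }.

(* The quotient by almost everywhere equality of the square integrable
   functions, on a type with its own linear structure: the library's
   LspaceType carries none. *)
Section L2_quotient.
Context d (T : measurableType d) (R : realType).
Context (mu : {measure set T -> \bar R}).

Definition L2_fun := LfunType mu (@lee1n R 2).
HB.instance Definition _ := GRing.Lmodule.on L2_fun.
Implicit Types f g h : L2_fun.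

Definition ae_zero : {pred L2_fun} :=
  fun f : L2_fun => `[< {ae mu, forall x, (f : T -> R) x = 0} >].

Fact ae_zero_zmod_closed : zmod_closed ae_zero.
Proof.
split=> [|f g /asboolP f0 /asboolP g0]; apply/asboolP; first exact/nearW.
apply: filterS2 f0 g0 => x fx gx.
by rewrite -[LHS]/((f : T -> R) x - (g : T -> R) x) fx gx subr0.
Qed.

HB.instance Definition _ := GRing.isZmodClosed.Build L2_fun ae_zero
  ae_zero_zmod_closed.

Definition L2 : Type := Quotient.quot ae_zero.
HB.instance Definition _ := GRing.Zmodule.on L2.

Definition L2_class (f : L2_fun) : L2 := (\pi_(Quotient.quot ae_zero) f)%qT.
Definition L2_repr (u : L2) : L2_fun := repr (u : Quotient.quot ae_zero).

Lemma L2_reprK u : L2_class (L2_repr u) = u.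
Proof. exact: reprK. Qed.

Lemma L2_classP f g : L2_class f = L2_class g <->
  {ae mu, forall x, (f : T -> R) x = g x}.
Proof.
split=> [/eqP|fg].
  rewrite -Quotient.idealrBE => /asboolP; apply: filterS => x.
  rewrite -[_ - _ = _]/((f : T -> R) x - (g : T -> R) x = 0).
  by move=> /eqP; rewrite subr_eq0 => /eqP.
apply/eqP; rewrite -Quotient.idealrBE; apply/asboolP.
apply: filterS fg => x fgx.
by rewrite -[LHS]/((f : T -> R) x - (g : T -> R) x) fgx subrr.
Qed.

Lemma L2_classD f g : L2_class (f + g) = L2_class f + L2_class g.
Proof. exact: (Quotient.pi_add ae_zero). Qed.

Lemma L2_class_reprae f :
  {ae mu, forall x, (L2_repr (L2_class f) : T -> R) x = f x}.
Proof. by apply/L2_classP; rewrite L2_reprK. Qed.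

Definition L2_scale (a : R) (u : L2) : L2 := L2_class (a *: L2_repr u).

Lemma L2_classZ a f : L2_class (a *: f) = L2_scale a (L2_class f).
Proof.
apply/esym/L2_classP; apply: filterS (L2_class_reprae f) => x fx.
by rewrite -[LHS]/(a * (L2_repr (L2_class f) : T -> R) x) fx.
Qed.

Fact L2_scaleA a b u : L2_scale a (L2_scale b u) = L2_scale (a * b) u.
Proof. by rewrite -[u]L2_reprK -!L2_classZ scalerA. Qed.

Fact L2_scale1 : left_id 1 L2_scale.
Proof. by move=> u; rewrite -[u]L2_reprK -!L2_classZ scale1r. Qed.

Fact L2_scaleDr : right_distributive L2_scale +%R.
Proof.
move=> a u v; rewrite -[u]L2_reprK -[v]L2_reprK.
by rewrite -!(L2_classD, L2_classZ) scalerDr.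
Qed.

Fact L2_scaleDl u : {morph L2_scale^~ u : a b / a + b}.
Proof.
by move=> a b; rewrite -[u]L2_reprK -!L2_classZ scalerDl L2_classD.
Qed.

HB.instance Definition _ := GRing.Zmodule_isLmodule.Build R L2
  L2_scaleA L2_scale1 L2_scaleDr L2_scaleDl.

Definition L2_inner (u v : L2) : R :=
  \int[mu]_x ((L2_repr u : T -> R) x * (L2_repr v : T -> R) x).

Lemma L2_fun_integrable f g :
  mu.-integrable setT (EFin \o (fun x => (f : T -> R) x * (g : T -> R) x)).
Proof.
by apply/Lfun1_integrable; apply: (@Lfun2_mul_Lfun1 _ _ _ mu f g); exact: LfunP.
Qed.

Lemma L2_inner_class f g :
  L2_inner (L2_class f) (L2_class g) =
  \int[mu]_x ((f : T -> R) x * (g : T -> R) x).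
Proof.
congr fine; apply: ae_eq_integral => //.
- by have /integrableP[] := L2_fun_integrable
    (L2_repr (L2_class f)) (L2_repr (L2_class g)).
- by have /integrableP[] := L2_fun_integrable f g.
- by apply: filterS2 (L2_class_reprae f) (L2_class_reprae g) => x /= -> ->.
Qed.

Fact L2_innerC u v : L2_inner u v = L2_inner v u.
Proof. by apply: eq_Rintegral => x _; rewrite mulrC. Qed.

Fact L2_innerDl u v w : L2_inner (u + v) w = L2_inner u w + L2_inner v w.
Proof.
rewrite -[u]L2_reprK -[v]L2_reprK -[w]L2_reprK -L2_classD !L2_inner_class.
rewrite -RintegralD//; [|exact: L2_fun_integrable|exact: L2_fun_integrable].
by apply: eq_Rintegral => x _; rewrite -mulrDl.
Qed.

Fact L2_innerZl a u v : L2_inner (a *: u) v = a * L2_inner u v.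
Proof.
rewrite -[u]L2_reprK -[v]L2_reprK -[a *: _]L2_classZ !L2_inner_class.
rewrite -RintegralZl//; last exact: L2_fun_integrable.
by apply: eq_Rintegral => x _; rewrite mulrA.
Qed.

Fact L2_inner_ge0 u : 0 <= L2_inner u u.
Proof. by apply: Rintegral_ge0 => x _; rewrite -expr2; exact: sqr_ge0. Qed.

Fact L2_inner_eq0 u : L2_inner u u = 0 -> u = 0.
Proof.
rewrite -[u]L2_reprK L2_inner_class; set f := L2_repr u => f0.
have -> : 0 = L2_class 0.
  by rewrite -(scale0r f) L2_classZ -[RHS]/(0 *: L2_class f) scale0r.
apply/L2_classP.
have ff := L2_fun_integrable f f.
have /integrableP[mff _] := ff.
have : (\int[mu]_x `|((f : T -> R) x * (f : T -> R) x)%:E| = 0)%E.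
  under eq_integral do rewrite gee0_abs ?lee_fin -?expr2 ?sqr_ge0//.
  rewrite -[LHS]fineK; last first.
    by apply: integrable_fin_num => //; under eq_fun do rewrite expr2.
  by congr EFin; rewrite -[RHS]f0; congr fine; apply: eq_integral.
move/(ae_eq_integral_abs mu measurableT mff); apply: filterS => x /(_ I).
by rewrite /= => -[] /eqP; rewrite mulf_eq0 orbb => /eqP.
Qed.

Fact L2_inner0l u : L2_inner 0 u = 0.
Proof. by rewrite -(scale0r 0) L2_innerZl mul0r. Qed.

Definition L2_norm u : R := Num.sqrt (L2_inner u u).

Fact L2_norm_sqr u : L2_inner u u = L2_norm u ^+ 2.
Proof. by rewrite sqr_sqrtr ?L2_inner_ge0. Qed.

Fact L2_cauchy_schwarz u v : L2_inner u v <= L2_norm u * L2_norm v.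
Proof.
have [u0|u0] := eqVneq (L2_norm u) 0.
  have -> : u = 0 by apply: L2_inner_eq0; rewrite L2_norm_sqr u0 expr0n.
  by rewrite L2_inner0l mulr_ge0// sqrtr_ge0.
have [v0|v0] := eqVneq (L2_norm v) 0.
  have -> : v = 0 by apply: L2_inner_eq0; rewrite L2_norm_sqr v0 expr0n.
  by rewrite L2_innerC L2_inner0l mulr_ge0// sqrtr_ge0.
have ugt0 : 0 < L2_norm u by rewrite lt_def u0 sqrtr_ge0.
have vgt0 : 0 < L2_norm v by rewrite lt_def v0 sqrtr_ge0.
have := L2_inner_ge0 (L2_norm v *: u + (- L2_norm u) *: v).
rewrite L2_innerDl !(L2_innerC _ (_ + _)) !L2_innerDl.
rewrite !L2_innerZl !(L2_innerC _ (_ *: _)) !L2_innerZl (L2_innerC v u).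
rewrite !L2_norm_sqr.
move: (L2_inner u v) (L2_norm u) (L2_norm v) ugt0 vgt0 => p a b a0 b0 h.
have ab0 : 0 < a * b by rewrite mulr_gt0.
rewrite -(ler_pM2l ab0); nra.
Qed.

Fact L2_normD u v : L2_norm (u + v) <= L2_norm u + L2_norm v.
Proof.
rewrite -(@ler_pXn2r _ 2) ?nnegrE ?addr_ge0 ?sqrtr_ge0//.
rewrite -L2_norm_sqr L2_innerDl !(L2_innerC _ (_ + _)) !L2_innerDl.
rewrite (L2_innerC v u) !L2_norm_sqr sqrrD.
have := L2_cauchy_schwarz u v; lra.
Qed.

Fact L2_normZ a u : L2_norm (a *: u) = `|a| * L2_norm u.
Proof.
rewrite /L2_norm L2_innerZl L2_innerC L2_innerZl mulrA -expr2.
by rewrite sqrtrM ?sqr_ge0// sqrtr_sqr.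
Qed.

Fact L2_norm_eq0 u : L2_norm u = 0 -> u = 0.
Proof. by move=> u0; apply: L2_inner_eq0; rewrite L2_norm_sqr u0 expr0n. Qed.

HB.instance Definition _ := Lmodule_isNormed.Build R L2
  L2_normD L2_normZ L2_norm_eq0.

HB.instance Definition _ := isInnerProduct.Build R L2
  L2_innerC L2_innerDl L2_innerZl L2_norm_sqr.

End L2_quotient.

(* L^2(Omega), encoded through Borel functions on the whole space that are
   identified when they agree almost everywhere on Omega. *)
Definition L2_domain (R : realType) (n : nat) (Omega : set 'rV[R]_n)
    (Omega_open : open Omega) : innerProductType R :=
  L2 (mrestr (@lebesgue_Rn R n) (open_measurableRn Omega_open)).

Section smooth_boundary.
Context (R : realType) (n : nat).

Definition iter_derive (s : seq 'rV[R]_n) (rho : 'rV[R]_n -> R) :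
    'rV[R]_n -> R :=
  foldr (fun v h => fun x => 'D_v h x) rho s.

Definition smooth (rho : 'rV[R]_n -> R) :=
  forall s, continuous (iter_derive s rho) /\
    forall x v, derivable (iter_derive s rho) x v.

(* Local defining functions: near each boundary point, Omega is the sublevel
   set {rho < 0} of a smooth function with nonzero gradient at that point. *)
Definition smooth_boundary (Omega : set 'rV[R]_n) :=
  forall x, (closure Omega `&` closure (~` Omega)) x ->
    exists rho : 'rV[R]_n -> R, [/\ smooth rho,
      rho x = 0,
      exists v, 'D_v rho x != 0 &
      \forall y \near x, Omega y <-> rho y < 0].

End smooth_boundary.

(* A linear operator defined on a linear subspace; the values of op_fun
   outside op_dom are irrelevant. *)
Record operator (R : realType) (H : innerProductType R) := Operator {
  op_dom : set H ;
  op_fun :> H -> H ;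
  op_dom0 : op_dom 0 ;
  op_domP : forall a x y, op_dom x -> op_dom y -> op_dom (a *: x + y) ;
  op_linearP : forall a x y, op_dom x -> op_dom y ->
    op_fun (a *: x + y) = a *: op_fun x + op_fun y }.

Section operators.
Context (R : realType) (H : innerProductType R).
Implicit Types (A : operator H) (x y z : H) (l : R).

Definition op_unbounded A :=
  ~ exists M : R, forall x, op_dom A x -> `|A x| <= M * `|x|.

(* y is in the domain of the adjoint, which maps it to z *)
Definition adjoint_graph A y z :=
  forall x, op_dom A x -> inner (A x) y = inner x z.

Definition self_adjoint A :=
  dense (op_dom A) /\
  forall y z, adjoint_graph A y z <-> op_dom A y /\ z = A y.

Definition op_positive A :=
  forall x, op_dom A x -> x != 0 -> 0 < inner (A x) x.

Definition op_eigenvalue A l :=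
  exists x, [/\ op_dom A x, x != 0 & A x = l *: x].

Definition finite_multiplicity A l := exists s : seq H,
  forall x, op_dom A x -> A x = l *: x ->
    exists c : nat -> R, x = \sum_(i < size s) c i *: s`_i.

Definition resolvent_set A : set R := [set l | exists B : {linear H -> H},
  [/\ continuous B,
      forall y, op_dom A (B y) /\ A (B y) - l *: B y = y &
      forall x, op_dom A x -> B (A x - l *: x) = x]].

Definition spectrum A : set R := ~` resolvent_set A.

Definition discrete_spectrum A := forall l, spectrum A l ->
  [/\ \forall m \near l^', ~ spectrum A m,
      op_eigenvalue A l & finite_multiplicity A l].

End operators.

Record spectral_family (R : realType) (H : innerProductType R) :=
  SpectralFamily {
  sf_proj :> R -> {linear H -> H} ;
  sf_projM : forall l m x, sf_proj l (sf_proj m x) = sf_proj (Num.min l m) x ;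
  sf_sym : forall l x y, inner (sf_proj l x) y = inner x (sf_proj l y) ;
  sf_right_continuous : forall x, right_continuous (fun l => sf_proj l x) ;
  sf_cvgNy : forall x, sf_proj l x @[l --> -oo] --> (0 : H) ;
  sf_cvgy : forall x, sf_proj l x @[l --> +oo] --> x }.

Section spectral_calculus.
Context (R : realType) (H : innerProductType R) (E : spectral_family H).
Implicit Types (x y z : H) (F : R -> R).

Definition sf_distr x (l : R) : R := inner (E l x) x.

Fact sf_distrE x l : sf_distr x l = `|E l x| ^+ 2.
Proof. by rewrite /sf_distr -inner_norm -(sf_sym E) sf_projM minxx. Qed.

Fact innerBl x y z : inner (x - y) z = inner x z - inner y z.
Proof. by rewrite innerDl -scaleN1r innerZl mulN1r. Qed.

Fact sf_distr_sub l m x : l <= m ->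
  sf_distr x m - sf_distr x l = `|E m x - E l x| ^+ 2.
Proof.
move=> lm; rewrite -inner_norm innerBl !(innerC _ (_ - _)) !innerBl.
rewrite -!(sf_sym E) !sf_projM !minxx ?(min_l lm) ?(min_r lm) /sf_distr.
by rewrite subrr subr0.
Qed.

Fact sf_distr_nondecreasing x : nondecreasing (sf_distr x).
Proof. by move=> l m lm; rewrite -subr_ge0 sf_distr_sub// sqr_ge0. Qed.

Fact sf_distr_right_continuous x : right_continuous (sf_distr x).
Proof.
move=> l; rewrite (_ : sf_distr x = fun m => `|E m x| * `|E m x|).
  have Ex := cvg_norm (@sf_right_continuous _ _ E x l).
  exact: (cvgM (Ex _) (Ex _)).
by apply/funext => m; rewrite sf_distrE expr2.
Qed.

HB.instance Definition _ x := isCumulative.Build R _ R (sf_distr x)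
  (@sf_distr_nondecreasing x) (@sf_distr_right_continuous x).

(* d<E_l x, x> *)
Definition sf_measure x := lebesgue_stieltjes_measure (sf_distr x).

(* the integral of F against the signed measure d<E_l x, y>, which is defined
   by polarization *)
Definition sf_integral F x y : R :=
  4^-1 * (\int[sf_measure (x + y)]_l F l - \int[sf_measure (x - y)]_l F l).

(* A is the integral of l dE_l *)
Definition resolution_of (A : operator H) :=
  (forall x, op_dom A x <-> (\int[sf_measure x]_l (l ^+ 2)%:E < +oo)%E) /\
  (forall x y, op_dom A x -> op_dom A y ->
    inner (A x) y = sf_integral id x y).

(* F(A) x for a bounded Borel function F: the vector representing the linear
   form y |-> \int F d<E_l x, y> *)
Definition sf_apply F x : H :=
  xget 0 [set z | forall y, inner z y = sf_integral F x y].

Definition sobolev_sqr (s : R) x : \bar R :=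
  (\int[sf_measure x]_(l in `[0%R, +oo[) ((1 + l ^+ 2) `^ s)%:E)%E.

Definition sobolev (s : R) : set H := [set x | (sobolev_sqr s x < +oo)%E].

Definition sobolev_norm (s : R) x : R := Num.sqrt (fine (sobolev_sqr s x)).

Definition sobolev_continuous (s T : R) (u : R -> H) :=
  forall t, t \in `[0, T] -> sobolev s (u t) /\
    sobolev_norm s (u r - u t) @[r --> within `[0, T] (nbhs t)] --> (0 : R).

End spectral_calculus.

Section wave_equation.
Context (R : realType) (H : innerProductType R).
Variables (E : spectral_family H) (A : operator H) (T : R).

Definition diff_quotient (u : R -> H) (t r : R) : H :=
  (r - t)^-1 *: (u r - u t).

(* one-sided derivatives at the end points of [0, T] *)
Definition time_derive (u : R -> H) (t : R) : H :=
  lim (diff_quotient u t r @[r --> within `[0, T] t^']).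

(* A^2 u(t) is the functional psi |-> <A u(t), A psi> on H^1 = op_dom A: the
   equation is read in the dual of H^1. *)
Definition wave_solution (u : R -> H) :=
  [/\ sobolev_continuous E 1 T u,
      forall t, t \in `[0, T] ->
        cvg (diff_quotient u t r @[r --> within `[0, T] t^']),
      {within `[0, T], continuous (time_derive u)} &
      forall (psi : H) (t : R), op_dom A psi -> t \in `]0, T[ ->
        is_derive t (1 : R) (fun r => inner (time_derive u r) psi : R)
          (- inner (A (u t)) (A psi))].

Definition cosA (x : H) : H := sf_apply E (fun l => cos (l * T)) x.
Definition sinA (x : H) : H := sf_apply E (fun l => sin (l * T)) x.

Definition iteration_map (f g phi : H) : H :=
  cosA (cosA phi) - cosA (sinA (A f)) + sinA (A g).

End wave_equation.

(* Main.v *)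
Require Import Defs.
From mathcomp Require Import all_boot all_order all_algebra.
From mathcomp Require Import all_classical all_reals all_analysis.
From mathcomp Require Import measurable_realfun lra ring.
Import Order.TTheory GRing.Theory Num.Theory.
Import numFieldNormedType.Exports.
Set Implicit Arguments.
Unset Strict Implicit.
Unset Printing Implicit Defensive.
Local Open Scope classical_set_scope.
Local Open Scope ring_scope.

(** Write psi for the initial velocity of the solution u. Because u(T) = g, the
    spectral components of psi satisfy, at each eigenvalue s of A,
      A g = cos(sT) A f + sin(sT) psi,
    and substituting this into the iteration turns its step into
      phi - psi  |->  cos(AT)^2 (phi - psi).
    Positivity and nonresonance make sin(sT) nonzero, hence cos(sT)^2 < 1, at
    every eigenvalue: each spectral component of the error decays
    geometrically. There is no uniform rate, but the powers of cos(AT)^2 are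
    contractions, so the energy that the error carries at high frequencies
    stays below that of the initial error, which is small; this gives
    convergence in norm.

    The argument never diagonalizes A globally. It works with the projections
    P_]a,b] = E_b - E_a and with intervals ]a, b] of a special kind, called
    atoms below, on which E jumps at one point s at most.
    - On the range of P_]a,b] the operator A is within the distance
      max |t - l|, t in ]a, b], of the scalar l ([op_near_scalar]). Hence a
      bounded inverse of A - l forces E to be constant near l
      ([resolvent_locally_cst]), and on an atom A acts as the scalar s
      ([atom_eigen]).
    - As the spectrum is discrete, every point of the line has a neighbourhood
      whose subintervals are atoms ([locally_atom]). By a covering argument
      ([cousin]), a property of intervals that is stable under concatenation
      holds on all bounded intervals as soon as it holds on atoms ([atom_ind]).
    - A function F(A) is defined only through its matrix coefficients, so that
      the vector F(A) x must be produced: it is built on bounded intervals with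
      [atom_ind], and then by passing to the limit. This limit is where the
      completeness of L^2 is used, proved first as [L2_complete]. On an atom,
      F(A) acts as the scalar F(s) ([sf_apply_atom]).
    - Tested against an eigenvector, the wave equation becomes a scalar harmonic
      oscillator ([oscillator]), which gives the displayed relation between f,
      g and psi ([wave_atom]). *)

(** * Completeness of L^2 *)

Definition seq_complete (R : realType) (V : normedModType R) :=
  forall u : nat -> V,
    (forall e : R, 0 < e ->
      exists N, forall n, (N <= n)%N -> `|u n - u N| <= e) ->
    exists w : V, u n @[n --> \oo] --> w.

Section complete.
Context d (T : measurableType d) (R : realType).
Context (mu : {measure set T -> \bar R}).

Lemma square_integrable_Lfun2 (f : T -> R) : measurable_fun setT f ->
  (\int[mu]_x (f x ^+ 2)%:E < +oo)%E -> f \in Lfun mu 2%:E.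
Proof.
move=> mf fi; rewrite inE; apply/andP; split; rewrite inE//=.
rewrite /finite_norm unlock /=.
apply: poweR_lty.
by under eq_integral do rewrite powR_mulrn// real_normK ?num_real//.
Qed.

Lemma L2_norm_class (f : L2_fun mu) :
  ((`|L2_class f| ^+ 2)%:E = \int[mu]_x ((f : T -> R) x ^+ 2)%:E)%E.
Proof.
rewrite -inner_norm -[inner _ _]/(L2_inner _ _) L2_inner_class.
have ff := L2_fun_integrable f f.
rewrite /Rintegral fineK; last first.
  exact: integrable_fin_num.
by apply: eq_integral => x _; rewrite expr2.
Qed.

Lemma L2_classB (f g : L2_fun mu) : L2_class f - L2_class g = L2_class (f - g).
Proof. by rewrite -scaleN1r -[_ *: _]L2_classZ -L2_classD scaleN1r. Qed.


Lemma einf_le_bound (u : (\bar R)^nat) (c : \bar R) :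
  (forall n, u n <= c)%E -> (limn_einf u <= c)%E.
Proof.
move=> uc; rewrite limn_einf_lim; apply: lime_le; first exact: is_cvg_einfs.
apply: nearW => n; apply: le_trans (uc n).
by apply: ereal_inf_lbound; exists n => /=.
Qed.

Lemma cvg_seq_EFin (a : R ^nat) (l : R) :
  a n @[n --> \oo] --> l -> (a n)%:E @[n --> \oo] --> l%:E.
Proof. by move=> al; apply: cvg_EFin => //; exact: nearW. Qed.

(** The increments are at most sqrt C * 2^-n, so that the telescoping series
    of the sequence converges absolutely. *)
Lemma geometric_diff_cvg (a : R ^nat) (C : R) :
  (forall n, 4 ^+ n * (a n.+1 - a n) ^+ 2 <= C) -> cvg (a @ \oo).
Proof.
move=> aC.
have C0 : 0 <= C by apply: le_trans (aC 0%N); rewrite mulr_ge0// sqr_ge0.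
have Da n : `|telescope a n| <= geometric (Num.sqrt C) 2^-1 n.
  rewrite /telescope /= exprVn -ler_pdivrMr ?invr_gt0 ?exprn_gt0// invrK.
  rewrite -(@ler_pXn2r _ 2) ?nnegrE ?sqrtr_ge0 ?mulr_ge0 ?exprn_ge0//.
  rewrite sqr_sqrtr// exprMn real_normK ?num_real// -exprM mulnC exprM mulrC.
  by rewrite -natrX; exact: aC.
have : cvg (series (telescope a) @ \oo).
  apply: normed_cvg; apply: (@series_le_cvg _ _ (geometric (Num.sqrt C) 2^-1)).
  - by move=> n; exact: normr_ge0.
  - by move=> n; rewrite /= mulr_ge0 ?sqrtr_ge0// exprn_ge0// invr_ge0.
  - exact: Da.
  - apply: is_cvg_geometric_series.
    by rewrite ger0_norm ?invr_ge0// invf_lt1 ?ltr1n.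
move=> sc.
suff -> : a = (fun n => a 0%N + series (telescope a) n).
  exact: (is_cvgD (is_cvg_cst _) sc).
by apply/funext => n; rewrite telescopeK addrC subrK.
Qed.

Lemma L2_dist_class (u v : L2 mu) : ((`|u - v| ^+ 2)%:E =
  \int[mu]_x (((L2_repr u : T -> R) x - (L2_repr v : T -> R) x) ^+ 2)%:E)%E.
Proof.
by rewrite -{1}[u]L2_reprK -{1}[v]L2_reprK L2_classB L2_norm_class.
Qed.

(** The weights 4^n are chosen so that the sum of 4^n |f_(n+1) - f_n|^2 is
    integrable when the norms decay like 4^-n; this sum is therefore finite
    almost everywhere, where it forces pointwise convergence. Fatou's lemma then
    bounds the distance of the pointwise limit to each f_n. *)
Lemma L2_rapid_cvg (w : nat -> L2 mu) :
  (forall n m, (n <= m)%N -> `|w m - w n| <= 4^-1 ^+ n) ->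
  exists W, forall n, `|W - w n| <= 4^-1 ^+ n.
Proof.
move=> wcauchy.
pose f n : T -> R := L2_repr (w n).
have mf n : measurable_fun setT (f n) by exact: measurable_funPT.
have mdf n m :
    measurable_fun setT (fun x => ((f n x - f m x) ^+ 2)%:E : \bar R).
  by apply/measurable_EFinP/measurable_funX/measurable_funB.
pose D n (x : T) : \bar R := (4 ^+ n * (f n.+1 x - f n x) ^+ 2)%:E.
have D0 n x : (0 <= D n x)%E by rewrite lee_fin mulr_ge0// sqr_ge0.
have mD n : measurable_fun setT (D n).
  apply/measurable_EFinP; apply: measurable_funM; first exact: measurable_cst.
  exact/measurable_funX/measurable_funB.
have iD n : (\int[mu]_x D n x <= (4^-1 ^+ n)%:E)%E.
  under eq_integral do rewrite /D EFinM.
  rewrite ge0_integralZl_EFin//; last by move=> x _; rewrite lee_fin sqr_ge0.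
  rewrite -L2_dist_class -EFinM lee_fin.
  have /= h := wcauchy n n.+1 (leqnSn n).
  have {}h : `|w n.+1 - w n| ^+ 2 <= (4^-1 ^+ n) ^+ 2.
    by rewrite ler_pXn2r ?nnegrE// exprn_ge0// invr_ge0.
  apply: (le_trans (ler_wpM2l _ h)); first exact: exprn_ge0.
  by rewrite expr2 mulrA exprVn divff ?expf_neq0// mul1r.
pose S (x : T) := (\sum_(n <oo) D n x)%E.
have mS : measurable_fun setT S by apply: ge0_emeasurable_sum.
have S0 x : (0 <= S x)%E by apply: nneseries_ge0.
have iS : (\int[mu]_x S x < +oo)%E.
  rewrite integral_nneseries//.
  apply: (@le_lt_trans _ _ (\sum_(n <oo) (4^-1 ^+ n : R)%:E)%E).
    apply: lee_nneseries => n; first by move=> _ _; exact: integral_ge0.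
    by move=> _; exact: iD.
  have h4 : `|4^-1 : R| < 1 by rewrite ger0_norm ?invr_ge0// invf_lt1 ?ltr1n.
  apply: (@le_lt_trans _ _ (1 * (1 - 4^-1)^-1)%:E); last exact: ltry.
  apply: lime_le.
    by apply: is_cvg_nneseries => n _ _; rewrite lee_fin exprn_ge0// invr_ge0.
  apply: nearW => n; rewrite sumEFin lee_fin.
  have := @geometric_le_lim R n 1 4^-1 ler01.
  rewrite /series /= /geometric /=.
  under eq_bigr do rewrite mul1r.
  by apply => //; rewrite invr_gt0.
have aeS : {ae mu, forall x, (S x < +oo)%E}.
  have : mu.-integrable setT S.
    apply/integrableP; split => //.
    by under eq_integral do rewrite gee0_abs//.
  move/(integrable_ae measurableT); apply: filterS => x /(_ I).
  by rewrite ge0_fin_numE.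
have aecvg : {ae mu, forall x, cvg (f n x @[n --> \oo])}.
  apply: filterS aeS => x Sx.
  apply: (@geometric_diff_cvg _ (fine (S x))) => n.
  rewrite -lee_fin fineK ?ge0_fin_numE//.
  have := @nneseries_lim_ge R (D^~ x) xpredT 0 n.+1.
  rewrite big_mkord => h; apply: (le_trans _ (h _)) => //.
  by rewrite big_ord_recr/= leeDr// sume_ge0.
(* An upper limit is measurable without knowing where the sequence converges. *)
pose F x := fine (limn_esup (fun n => (f n x)%:E)).
have mF : measurable_fun setT F.
  apply: measurableT_comp => //.
  by apply: measurable_fun_limn_esup => n; exact/measurable_EFinP.
have aeF : {ae mu, forall x, f n x @[n --> \oo] --> F x}.
  apply: filterS aecvg => x cx.
  suff -> : F x = limn (f^~ x) by [].
  by have [_] := cvg_limn_einf_sup (cvg_seq_EFin cx); rewrite /F => ->.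
have iF n : (\int[mu]_x ((F x - f n x) ^+ 2)%:E <= ((4^-1 ^+ n) ^+ 2)%:E)%E.
  have le1 : (\int[mu]_x ((F x - f n x) ^+ 2)%:E <=
      \int[mu]_x limn_einf (fun m => ((f (m + n)%N x - f n x) ^+ 2)%:E))%E.
    apply: ae_ge0_le_integral => //.
    - by move=> x _; rewrite lee_fin sqr_ge0.
    - by apply/measurable_EFinP/measurable_funX/measurable_funB.
    - move=> x _; rewrite limn_einf_lim; apply: lime_ge.
        exact: is_cvg_einfs.
      apply: nearW => m; apply: le_ereal_inf_tmp => _ [k /= _ <-].
      by rewrite lee_fin sqr_ge0.
    - under eq_fun do rewrite limn_einf_lim -limn_einf_lim /limn_einf.
      apply: measurableT_comp => //.
      apply: measurable_fun_limn_esup => m.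
      exact: measurableT_comp.
    - apply: filterS aeF => x Fx _.
      have cvx : ((f (m + n)%N x - f n x) ^+ 2)%:E @[m --> \oo] -->
          ((F x - f n x) ^+ 2)%:E.
        apply: cvg_seq_EFin.
        have h : f (m + n)%N x - f n x @[m --> \oo] --> F x - f n x.
          apply: cvgB; last exact: cvg_cst.
          by move: Fx; rewrite -(cvg_shiftn n).
        have -> : (fun m => (f (m + n)%N x - f n x) ^+ 2) = 
           (fun m => (f (m + n)%N x - f n x) * (f (m + n)%N x - f n x)).
          by apply/funext => m; rewrite expr2.
        by rewrite expr2; apply: cvgM.
      by have [-> _] := cvg_limn_einf_sup cvx.
  apply: (le_trans le1).
  apply: (le_trans (fatou mu measurableT (fun m => mdf (m + n)%N n) _)).
    by move=> m x _; rewrite lee_fin sqr_ge0.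
  apply: einf_le_bound => m.
  rewrite -L2_dist_class lee_fin ler_pXn2r ?nnegrE// ?exprn_ge0 ?invr_ge0//.
  exact/wcauchy/leq_addl.
have dF n : (fun x => F x - f n x) \in Lfun mu 2%:E.
  apply: square_integrable_Lfun2; first exact: measurable_funB.
  by apply: le_lt_trans (iF n) _; exact: ltry.
pose G n : L2_fun mu := Lfun_Sub (@lee1n R 2) (dF n).
exists (L2_class (G 0%N) + w 0%N) => n.
have -> : L2_class (G 0%N) + w 0%N - w n = L2_class (G n).
  rewrite -[X in _ + X - _]L2_reprK -[X in _ - X]L2_reprK -L2_classD L2_classB.
  congr L2_class; apply/LfuneqP => x.
  rewrite -[LHS]/(F x - f 0%N x + f 0%N x - f n x).
  by rewrite subrK.
rewrite -(@ler_pXn2r _ 2) ?nnegrE// ?exprn_ge0 ?invr_ge0//.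
by rewrite -lee_fin L2_norm_class; exact: iF.
Qed.

(** The Riesz-Fischer theorem: a Cauchy sequence has a subsequence that
    converges at the geometric rate of [L2_rapid_cvg]. *)
Theorem L2_complete : seq_complete (L2 mu).
Proof.
move=> u uC.
have e2 (n : nat) : 0 < 4^-1 ^+ n / 2 :> R.
  by rewrite divr_gt0// exprn_gt0// invr_gt0.
have [N Nu] := choice (fun n => uC _ (e2 n)).
(* Unlike N, the ranks K n are nondecreasing, as a subsequence requires. *)
pose K n := \max_(i < n.+1) N i.
have Nuu n p q : (N n <= p)%N -> (N n <= q)%N -> `|u p - u q| <= 4^-1 ^+ n.
  move=> /Nu p1 /Nu q1.
  rewrite -(subrKA (u (N n))) (le_trans (ler_normD _ _))//.
  rewrite [leRHS]splitr lerD// distrC//.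
have NK n m : (n <= m)%N -> (N n <= K m)%N.
  move=> nm; rewrite /K.
  exact: (@leq_bigmax_cond _ xpredT (fun i : 'I_m.+1 => N i)
    (Ordinal (nm : (n < m.+1)%N))).
have [W WK] := @L2_rapid_cvg (u \o K)
  (fun n m nm => Nuu _ _ _ (NK _ _ nm) (NK _ _ (leqnn n))).
exists W; apply/cvgrPdist_le => e e0.
have [n ne] : exists n, 4^-1 ^+ n * 2 <= e.
  have /cvgrPdist_le/(_ e e0)[n _ /(_ n (leqnn n))] :
      geometric (2 : R) 4^-1 @ \oo --> (0 : R).
    by apply: cvg_geometric; rewrite ger0_norm ?invr_ge0// invf_lt1 ?ltr1n.
  rewrite /= sub0r normrN ger0_norm; first by exists n; rewrite mulrC.
  by rewrite mulr_ge0// exprn_ge0// invr_ge0.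
exists (N n) => // m /= nm.
rewrite -(subrKA (u (K n))) (le_trans (ler_normD _ _))//.
apply: le_trans ne; rewrite mulr_natr mulr2n; apply: lerD; first exact: WK.
exact: Nuu (NK _ _ (leqnn n)) nm.
Qed.

End complete.

(** * Inner products and spectral projections *)

Section inner_product.
Context (R : realType) (H : innerProductType R).
Implicit Types (x y z : H).

Lemma innerDr x y z : inner x (y + z) = inner x y + inner x z.
Proof. by rewrite innerC innerDl !(innerC x). Qed.

Lemma innerZr a x y : inner x (a *: y) = a * inner x y.
Proof. by rewrite innerC innerZl innerC. Qed.

Lemma innerBr x y z : inner x (y - z) = inner x y - inner x z.
Proof. by rewrite innerC innerBl !(innerC x). Qed.

Lemma inner0l y : inner 0 y = 0.
Proof. by rewrite -(subrr 0) innerBl subrr. Qed.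

Lemma inner0r y : inner y 0 = 0.
Proof. by rewrite innerC inner0l. Qed.

Lemma inner_normD x y : `|x + y| ^+ 2 = `|x| ^+ 2 + 2 * inner x y + `|y| ^+ 2.
Proof. by rewrite -!inner_norm innerDl !innerDr (innerC y x); ring. Qed.

Lemma inner_normB x y : `|x - y| ^+ 2 = `|x| ^+ 2 - 2 * inner x y + `|y| ^+ 2.
Proof. by rewrite -!inner_norm innerBl !innerBr (innerC y x); ring. Qed.

(** The weighted form of the Cauchy-Schwarz inequality, from the
    nonnegativity of |c x - y|^2. *)
Lemma inner_le_half x y c : 0 < c ->
  inner x y <= 2^-1 * (c * `|x| ^+ 2 + c^-1 * `|y| ^+ 2).
Proof.
move=> c0; have := sqr_ge0 `|c *: x - y|; rewrite inner_normB normrZ gtr0_norm//.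
rewrite innerZl exprMn => h.
have {}h : 0 <= c^-1 * (c ^+ 2 * `|x| ^+ 2 - 2 * (c * inner x y) + `|y| ^+ 2).
  by rewrite mulr_ge0// invr_ge0 ltW.
have e : c^-1 * (c ^+ 2 * `|x| ^+ 2 - 2 * (c * inner x y) + `|y| ^+ 2) =
   c * `|x| ^+ 2 - 2 * inner x y + c^-1 * `|y| ^+ 2 by field; rewrite gt_eqF.
by rewrite e in h; lra.
Qed.

Lemma inner_cauchy_schwarz x y : `|inner x y| <= `|x| * `|y|.
Proof.
wlog xy0 : x / 0 <= inner x y => [hw|].
  have [/hw//|xy0] := leP 0 (inner x y).
  have := hw (- x); rewrite -scaleN1r innerZl scaleN1r !normrN mulN1r normrN.
  by apply; rewrite oppr_ge0 ltW.
rewrite ger0_norm//.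
have [->|x0] := eqVneq x 0; first by rewrite inner0l normr0 mul0r.
have [->|y0] := eqVneq y 0; first by rewrite inner0r normr0 mulr0.
have nx0 : 0 < `|x| by rewrite normr_gt0.
have ny0 : 0 < `|y| by rewrite normr_gt0.
have := @inner_le_half x y (`|y| / `|x|) (divr_gt0 ny0 nx0).
move/le_trans; apply; rewrite le_eqVlt; apply/orP; left; apply/eqP.
by field; rewrite !gt_eqF.
Qed.

Lemma inner_ext x y : (forall z, inner x z = inner y z) -> x = y.
Proof.
move=> xy; apply/eqP; rewrite -subr_eq0 -normr_eq0 -sqrf_eq0 -inner_norm.
by rewrite innerBl xy subrr.
Qed.

(** By polarization, the inner product inherits its continuity from the
    norm. *)
Lemma cvg_inner (T : Type) (F : set_system T) {FF : Filter F} (f g : T -> H)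
    (x y : H) :
  f t @[t --> F] --> x -> g t @[t --> F] --> y ->
  inner (f t) (g t) @[t --> F] --> inner x y.
Proof.
move=> fx gy.
have h t : inner (f t) (g t) = 4^-1 * (`|f t + g t| ^+ 2 - `|f t - g t| ^+ 2).
  by rewrite inner_normD inner_normB; field.
under eq_fun do rewrite h.
have -> : inner x y = 4^-1 * (`|x + y| ^+ 2 - `|x - y| ^+ 2).
  by rewrite inner_normD inner_normB; field.
apply: cvgMl_tmp; under eq_fun do rewrite !expr2.
have c1 : `|f t + g t| @[t --> F] --> `|x + y| by apply: cvg_norm; apply: cvgD.
have c2 : `|f t - g t| @[t --> F] --> `|x - y| by apply: cvg_norm; apply: cvgB.
rewrite !expr2; apply: cvgB.
  by apply: cvgM.
by apply: cvgM.
Qed.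

End inner_product.

Section spectral_measure.
Context (R : realType) (H : innerProductType R) (E : spectral_family H).
Implicit Types (x y z w : H) (a b c l m s t : R) (F : R -> R).

Definition spec_proj a b x : H := E b x - E a x.
Local Notation P := spec_proj.

Lemma spec_projD a b x y : P a b (x + y) = P a b x + P a b y.
Proof. by rewrite /P !(linearD (E _)) opprD addrACA. Qed.

Lemma spec_projZ a b c x : P a b (c *: x) = c *: P a b x.
Proof.
have e l : E l (c *: x) = c *: E l x by exact: linearZZ.
by rewrite /P !e scalerBr.
Qed.

Lemma spec_projB a b x y : P a b (x - y) = P a b x - P a b y.
Proof. by rewrite -scaleN1r spec_projD spec_projZ scaleN1r. Qed.

Lemma spec_proj_cat a b c x : P a c x = P a b x + P b c x.
Proof. by rewrite /P [RHS]addrC subrKA. Qed.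

Lemma spec_proj_sym a b x y : inner (P a b x) y = inner x (P a b y).
Proof. by rewrite innerBl innerBr !(sf_sym E). Qed.

Lemma spec_proj_comp a b c d x : P a b (P c d x) =
  (E (Num.min b d) x - E (Num.min b c) x) -
  (E (Num.min a d) x - E (Num.min a c) x).
Proof. by rewrite /P !(linearB (E _)) !sf_projM. Qed.

Lemma spec_projC a b l x : P a b (E l x) = E l (P a b x).
Proof. by rewrite /spec_proj (linearB (E _)) !(sf_projM E) !(minC l). Qed.

Lemma spec_proj_id a b x : a <= b -> P a b (P a b x) = P a b x.
Proof.
move=> ab; rewrite spec_proj_comp !minxx (min_l ab) (min_r ab).
by rewrite subrr subr0.
Qed.

Lemma spec_proj_disj a b c d x : a <= b -> b <= c -> c <= d ->
  P a b (P c d x) = 0.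
Proof.
move=> ab bc cd; rewrite spec_proj_comp.
rewrite !min_l ?subrr//; [exact: le_trans bc|exact: le_trans (le_trans bc _)..|].
exact: (le_trans bc cd).
Qed.

Lemma spec_proj_disjr a b c d x : a <= b -> b <= c -> c <= d ->
  P c d (P a b x) = 0.
Proof.
move=> ab bc cd; rewrite spec_proj_comp.
by rewrite !min_r ?subrr//; lra.
Qed.

Lemma spec_proj_sub a b c d x : c <= a -> a <= b -> b <= d ->
  P c d (P a b x) = P a b x.
Proof.
move=> ca ab bd; rewrite spec_proj_comp.
by rewrite !(min_r (_ : _ <= d)) ?(min_l (_ : c <= _)) ?subrr ?subr0//; lra.
Qed.

Lemma sqr_norm_spec_proj a b x : a <= b ->
  `|P a b x| ^+ 2 = sf_distr E x b - sf_distr E x a.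
Proof. by move=> ab; rewrite sf_distr_sub. Qed.

(** An orthogonal projection is a contraction: |Qx|^2 = <Qx, x>. *)
Lemma le_norm_idem (Q : H -> H) x :
  (forall u v, inner (Q u) v = inner u (Q v)) -> Q (Q x) = Q x ->
  `|Q x| <= `|x|.
Proof.
move=> Qs QQ; have h : `|Q x| ^+ 2 <= `|x| * `|Q x|.
  by rewrite -inner_norm Qs QQ (le_trans (ler_norm _))// inner_cauchy_schwarz.
have [->//|Q0] := eqVneq `|Q x| 0.
have Qp : 0 < `|Q x| by rewrite lt_def Q0 normr_ge0.
by rewrite -(ler_pM2r Qp) -expr2.
Qed.

Lemma sf_distr_le x l : sf_distr E x l <= `|x| ^+ 2.
Proof.
rewrite sf_distrE ler_pXn2r ?nnegrE//; apply: le_norm_idem; first exact: sf_sym.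
by move=> *; rewrite sf_projM minxx.
Qed.

Lemma norm_spec_proj_le a b x : a <= b -> `|P a b x| <= `|x|.
Proof.
move=> ab; apply: le_norm_idem; first exact: spec_proj_sym.
exact: spec_proj_id.
Qed.

Lemma cvg_spec_proj a b (u : nat -> H) x : a <= b ->
  u n @[n --> \oo] --> x -> P a b (u n) @[n --> \oo] --> P a b x.
Proof.
move=> ab /cvgrPdist_le ux; apply/cvgrPdist_le => e e0.
apply: filterS (ux e e0) => n; apply: le_trans.
by rewrite -spec_projB norm_spec_proj_le.
Qed.

Lemma sf_distr_cvgNy x : sf_distr E x l @[l --> -oo] --> (0 : R).
Proof.
under eq_fun do rewrite sf_distrE -inner_norm.
by rewrite -(inner0l (0 : H)); apply: cvg_inner; exact: sf_cvgNy.
Qed.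

Lemma sf_distr_cvgy x : sf_distr E x l @[l --> +oo] --> `|x| ^+ 2.
Proof.
under eq_fun do rewrite sf_distrE -inner_norm.
by rewrite -inner_norm; apply: cvg_inner; exact: sf_cvgy.
Qed.

Lemma cvg_opp_nat : - n%:R @[n --> \oo] --> (-oo : set_system R).
Proof. exact: (cvgNrNy _).2 cvgr_idn. Qed.

Lemma cvg_spec_proj_total x :
  P (- n%:R) n%:R x @[n --> \oo] --> x.
Proof.
rewrite -[X in _ --> X]subr0; apply: cvgB.
  exact: (cvg_comp _ (fun l => E l x) cvgr_idn (@sf_cvgy _ _ E x)).
exact: (cvg_comp _ (fun l => E l x) cvg_opp_nat (@sf_cvgNy _ _ E x)).
Qed.

Lemma sf_measure_ocitv x a b : a <= b ->
  sf_measure E x `]a, b]%classic = (sf_distr E x b - sf_distr E x a)%:E.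
Proof.
move=> ab; rewrite /sf_measure /lebesgue_stieltjes_measure /measure_extension.
rewrite measurable_mu_extE/=; last exact: is_ocitv.
by rewrite wlength_itv_bnd.
Qed.

Lemma sf_measureT x : sf_measure E x setT = (`|x| ^+ 2)%:E.
Proof.
have mT : (\bigcup_n `](- n%:R)%R, n%:R]%classic : set R) = setT.
  rewrite -subTset => t _; exists (Num.bound `|t|) => //=.
  have := archi_boundP (normr_ge0 t).
  by rewrite in_itv/= ltr_norml => /andP[-> /ltW ->].
have := @nondecreasing_cvg_mu _ _ _ (sf_measure E x)
  (fun n => `](- n%:R)%R, n%:R]%classic).
rewrite mT => /(_ _ _ _) h.
have {h} : sf_measure E x `](- n%:R)%R, n%:R]%classic @[n --> \oo] -->
    sf_measure E x setT.
  apply: h => //.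
  by move=> m n mn; apply/subsetPset/subset_itv; rewrite bnd_simp ?lerN2 ler_nat.
have e n : sf_measure E x `](- n%:R)%R, n%:R]%classic =
    (sf_distr E x n%:R - sf_distr E x (- n%:R))%:E.
  by rewrite sf_measure_ocitv// lerNl (le_trans _ (ler0n _ _))// oppr_le0.
rewrite (eq_cvg _ _ e) => h1.
have h2 : (sf_distr E x n%:R - sf_distr E x (- n%:R))%:E @[n --> \oo] -->
    (`|x| ^+ 2)%:E.
  apply: cvg_EFin; first exact: nearW.
  rewrite -[X in _ --> X]subr0; apply: cvgB.
    exact: (cvg_comp _ _ cvgr_idn (@sf_distr_cvgy x)).
  exact: (cvg_comp _ _ cvg_opp_nat (@sf_distr_cvgNy x)).
exact: (cvg_unique _ h1 h2).
Qed.

End spectral_measure.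

(** * Integrals against the spectral measures *)

Section near_constant.
Context d (T : measurableType d) (R : realType) (mu : {measure set T -> \bar R}).
Implicit Types (D : set T) (F : T -> R) (c e : R).

Lemma near_cst_integrable D F c e : measurable D -> (mu D < +oo)%E ->
  measurable_fun D F -> (forall x, D x -> `|F x - c| <= e) ->
  mu.-integrable D (EFin \o F).
Proof.
move=> mD Doo mF Fc; apply: measurable_bounded_integrable => //.
exists (`|c| + e); split; first exact: num_real.
move=> M ltM x Dx; apply/ltW/(le_lt_trans _ ltM).
by rewrite -(subrK c (F x)) (le_trans (ler_normD _ _))// addrC lerD// Fc.
Qed.

Lemma Rintegral_near_cst D F c e : measurable D -> (mu D < +oo)%E ->
  measurable_fun D F -> (forall x, D x -> `|F x - c| <= e) ->
  `|\int[mu]_(x in D) F x - c * fine (mu D)| <= e * fine (mu D).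
Proof.
move=> mD Doo mF Fc.
have iF := near_cst_integrable mD Doo mF Fc.
have ic k : mu.-integrable D (EFin \o cst k).
  by apply: (@near_cst_integrable D _ k 0) => // x _; rewrite subrr normr0.
rewrite -!(Rintegral_cst _ mD) -RintegralB//; last exact: ic.
have iB : mu.-integrable D (EFin \o (fun x => F x - c)).
  apply: (@near_cst_integrable D _ 0 e) => //.
    by apply: measurable_funB.
  by move=> x Dx; rewrite subr0 Fc.
apply: (le_trans (le_normr_Rintegral mD iB)).
apply: le_Rintegral => //; last exact: ic.
apply: (@near_cst_integrable D _ 0 e) => //.
  by apply: measurableT_comp => //; exact: measurable_funB.
by move=> x Dx; rewrite subr0 normr_id Fc.
Qed.

End near_constant.

Section interval_integrals.
Context (R : realType) (H : innerProductType R) (E : spectral_family H).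
Implicit Types (x y z w : H) (a b c l m s t : R) (F : R -> R).
Local Notation P := (spec_proj E).
Local Notation mu := (sf_measure E).

Lemma sf_measure_fin w (D : set (measurableTypeR R)) :
  measurable D -> (mu w D < +oo)%E.
Proof.
move=> mD; apply: (@le_lt_trans _ _ (mu w setT)).
  by apply: le_measure; rewrite ?inE.
by rewrite sf_measureT ltry.
Qed.

Definition itv_integral F w a b : R := \int[mu w]_(l in `]a, b]) F l.

(** With c = 0 this bounds an integral by the mass of ]a, b]; with e small, it
    evaluates the integral. *)
Lemma itv_integral_near F w a b c e : a <= b -> measurable_fun setT F ->
  (forall l, a < l <= b -> `|F l - c| <= e) ->
  `|itv_integral F w a b - c * (sf_distr E w b - sf_distr E w a)| <=
  e * (sf_distr E w b - sf_distr E w a).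
Proof.
move=> ab mF Fc.
have mI : measurable (`]a, b]%classic : set (measurableTypeR R)).
  exact: measurable_itv.
have := @Rintegral_near_cst _ _ _ (mu w) `]a, b]%classic F c e mI.
have -> : fine (mu w `]a, b]%classic) = sf_distr E w b - sf_distr E w a.
  by rewrite sf_measure_ocitv.
apply; first exact: sf_measure_fin.
  exact: measurable_funTS.
by move=> l; rewrite /= in_itv/=; exact: Fc.
Qed.

Section bounded.
Variables (F : R -> R) (M : R).
Hypothesis mF : measurable_fun setT F.
Hypothesis FM : forall l, `|F l| <= M.

Lemma bounded_sf_integrable w (D : set (measurableTypeR R)) : measurable D ->
  (mu w).-integrable D (EFin \o F).
Proof.
move=> mD; apply: (@near_cst_integrable _ _ _ _ D F 0 M) => //.
- exact: sf_measure_fin.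
- exact: measurable_funTS.
- by move=> l _; rewrite subr0.
Qed.

Lemma itv_integral_cat w a b c : a <= b -> b <= c ->
  itv_integral F w a c = itv_integral F w a b + itv_integral F w b c.
Proof.
move=> ab bc; rewrite /itv_integral -Rintegral_setU//=; last 2 first.
- apply: bounded_sf_integrable.
  by apply: measurableU; exact: measurable_itv.
- apply/disj_setPS => l [] /=; rewrite !in_itv/=; lra.
by rewrite -itv_bndbnd_setU// bnd_simp.
Qed.

Lemma itv_integral_null w a b : a <= b -> sf_distr E w a = sf_distr E w b ->
  itv_integral F w a b = 0.
Proof.
move=> ab dab; have := @itv_integral_near F w a b 0 M ab mF.
rewrite dab subrr !mulr0 subr0 => h; apply/eqP; rewrite -normr_le0 h//.
by move=> l _; rewrite subr0.
Qed.

(** The tail of the integral is at most M times the mass that the measure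
    leaves outside ]-n, n]. *)
Lemma cvg_itv_integral w :
  itv_integral F w (- n%:R) n%:R @[n --> \oo] --> \int[mu w]_l F l.
Proof.
have Pw : `|P (- n%:R) n%:R w| ^+ 2 @[n --> \oo] --> `|w| ^+ 2.
  have h : `|P (- n%:R) n%:R w| @[n --> \oo] --> `|w|.
    by apply: cvg_norm; exact: cvg_spec_proj_total.
  by under eq_fun do rewrite expr2; rewrite expr2; apply: cvgM; exact: h.
have M0 : 0 <= M by exact: le_trans (FM 0).
apply/cvgrPdist_le => e e0.
have eM : 0 < e / (M + 1) by rewrite divr_gt0// ltr_wpDl.
move/cvgrPdist_le: Pw => /(_ _ eM); apply: filterS => n Pwn.
have nn : - n%:R <= n%:R :> R by rewrite lerNl (le_trans _ (ler0n _ _))// oppr_le0.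
have mI : measurable (`](- n%:R), n%:R]%classic : set (measurableTypeR R)).
  exact: measurable_itv.
have mC := measurableC mI.
have -> : \int[mu w]_l F l = itv_integral F w (- n%:R) n%:R +
    \int[mu w]_(l in ~` `](- n%:R), n%:R]) F l.
  rewrite -Rintegral_setU//.
  - by rewrite setUv.
  - by rewrite setUv; exact: bounded_sf_integrable.
  - by apply/disj_setPS; rewrite setICr.
rewrite addrC addKr.
have := @Rintegral_near_cst _ _ _ (mu w) (~` `](- n%:R), n%:R]%classic) F 0 M mC.
have -> : fine (mu w (~` `](- n%:R), n%:R]%classic)) =
    `|w| ^+ 2 - `|P (- n%:R) n%:R w| ^+ 2.
  have : mu w setT = (mu w `](- n%:R)%R, n%:R]%classic +
      mu w (~` `](- n%:R)%R, n%:R]%classic))%E.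
    by rewrite -measureU// ?setICr// setUv.
  rewrite sf_measureT sf_measure_ocitv// -sqr_norm_spec_proj//.
  have := sf_measure_fin w mC.
  have := measure_ge0 (mu w) (~` `](- n%:R), n%:R]%classic).
  case: (mu w _) => [r| |]//= _ _ [->]; lra.
rewrite mul0r subr0 => /(_ _ _ _)/le_trans; apply.
- exact: sf_measure_fin.
- exact: measurable_funTS.
- by move=> l _; rewrite subr0.
apply: (@le_trans _ _ (M * (e / (M + 1)))).
  by rewrite ler_wpM2l// (le_trans (ler_norm _)).
by rewrite mulrA ler_pdivrMr ?ltr_wpDl// mulrDr mulr1 [e * M]mulrC lerDl ltW.
Qed.

End bounded.

End interval_integrals.

(** * The operator on spectral subspaces *)

Section spectral_operator.
Context (R : realType) (H : innerProductType R) (E : spectral_family H).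
Context (A : operator H) (EA : resolution_of E A).
Implicit Types (x y z w : H) (a b c l m s t : R) (F : R -> R).
Local Notation P := (spec_proj E).
Local Notation mu := (sf_measure E).

Lemma op_domB x y : op_dom A x -> op_dom A y -> op_dom A (x - y).
Proof. by move=> dx dy; rewrite addrC -scaleN1r; exact: op_domP. Qed.

Lemma sf_measure_eq x y : (forall l, sf_distr E x l = sf_distr E y l) ->
  forall D : set (measurableTypeR R), measurable D -> mu x D = mu y D.
Proof.
move=> xy; apply: lebesgue_stieltjes_measure_unique => X [[a b] _ <-] /=.
have [ab|ba] := leP a b.
  by rewrite -[LHS]/(mu x _) -[RHS]/(mu y _) !sf_measure_ocitv// !xy.
by rewrite set_itv_ge ?measure0// bnd_simp -leNgt ltW.
Qed.

(** The total mass is |w|^2, and a vector in the range of the projection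
    already has all of it on ]a, b]. *)
Lemma sf_measure_setC_range w a b : a <= b -> P a b w = w ->
  mu w (~` `]a, b]%classic) = 0.
Proof.
move=> ab Pw.
have mI : measurable (`]a, b]%classic : set (measurableTypeR R)).
  exact: measurable_itv.
have mC := measurableC mI.
have : mu w setT = (mu w `]a, b]%classic + mu w (~` `]a, b]%classic))%E.
  by rewrite -measureU// ?setICr// setUv.
rewrite sf_measureT sf_measure_ocitv// -sqr_norm_spec_proj// Pw.
have := sf_measure_fin E w mC; have := measure_ge0 (mu w) (~` `]a, b]%classic).
by case: (mu w _) => [r| |]//= _ _ [] => h; congr EFin; lra.
Qed.

Lemma spec_proj_dom a b x : a <= b -> op_dom A (P a b x).
Proof.
move=> ab; apply/(EA.1 _).2; set w := P a b x.
have Pw : P a b w = w by exact: spec_proj_id.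
pose c := Num.max `|a| `|b|.
have mI : measurable (`]a, b]%classic : set (measurableTypeR R)).
  exact: measurable_itv.
apply: (@le_lt_trans _ _ (\int[mu w]_l (cst (c ^+ 2)%:E) l)%E).
  apply: ae_ge0_le_integral => //.
  - by move=> l _; rewrite lee_fin sqr_ge0.
  - by apply/measurable_EFinP; exact: measurable_funX.
  - by move=> l _; rewrite lee_fin sqr_ge0.
  - exists (~` `]a, b]%classic); split.
    + exact: measurableC.
    + exact: sf_measure_setC_range.
    + move=> l /= nl lI; apply: nl => _.
      rewrite lee_fin -[leLHS]real_normK ?num_real//.
      have ca : - a <= c by rewrite /c le_max -normrN ler_norm.
      have cb : b <= c by rewrite /c le_max (ler_norm b) orbT.
      move: lI; rewrite /= in_itv/= => /andP[al lb].
      have lc : `|l| <= c by rewrite ler_norml; lra.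
      by rewrite ler_pXn2r// nnegrE// (le_trans _ lc).
by rewrite integral_cst// -[X in (_ * X)%E]/(mu w setT) sf_measureT -EFinM ltry.
Qed.

Lemma Rintegral_range F w a b : measurable_fun setT F -> a <= b ->
  P a b w = w -> \int[mu w]_l F l = itv_integral E F w a b.
Proof.
move=> mF ab Pw; rewrite /itv_integral /Rintegral [in RHS]integral_mkcond.
have mI : measurable (`]a, b]%classic : set (measurableTypeR R)).
  exact: measurable_itv.
have mF' : measurable_fun setT (EFin \o F) by exact/measurable_EFinP.
congr fine; apply: ae_eq_integral => //.
  by apply/(measurable_restrictT _ mI); exact: measurable_funTS.
exists (~` `]a, b]%classic); split.
- exact: measurableC.
- exact: sf_measure_setC_range.
- move=> l /= nl lI; apply: nl => _.
  by rewrite patchE mem_set.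
Qed.

Lemma id_integral_near w a b l c : a <= b -> P a b w = w ->
  (forall t, a < t <= b -> `|t - l| <= c) ->
  `|\int[mu w]_t t - l * `|w| ^+ 2| <= c * `|w| ^+ 2.
Proof.
move=> ab Pw lc; rewrite (@Rintegral_range id w a b)//.
have -> : `|w| ^+ 2 = sf_distr E w b - sf_distr E w a.
  by rewrite -sqr_norm_spec_proj// Pw.
by apply: itv_integral_near => //; exact: measurable_id.
Qed.

(** Polarization: <A x, y> is a quarter of the difference of the integrals of
    the identity against the spectral measures of x + y and x - y, both carried
    by ]a, b], and the parallelogram law adds up the two errors. *)
Lemma op_form_near x y a b l c : a <= b -> P a b x = x -> P a b y = y ->
  (forall t, a < t <= b -> `|t - l| <= c) ->
  `|inner (A x) y - l * inner x y| <= 2^-1 * c * (`|x| ^+ 2 + `|y| ^+ 2).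
Proof.
move=> ab Px Py lc.
have dx : op_dom A x by rewrite -Px; exact: spec_proj_dom.
have dy : op_dom A y by rewrite -Py; exact: spec_proj_dom.
rewrite EA.2// /sf_integral.
have Pp : P a b (x + y) = x + y by rewrite spec_projD Px Py.
have Pm : P a b (x - y) = x - y by rewrite spec_projB Px Py.
have hp := id_integral_near ab Pp lc; have hm := id_integral_near ab Pm lc.
rewrite (inner_normD x y) in hp; rewrite (inner_normB x y) in hm.
set I := (X in 4^-1 * (X - _)); set J := (X in 4^-1 * (_ - X)).
have {}hp : `|I - l * (`|x| ^+ 2 + 2 * inner x y + `|y| ^+ 2)| <=
    c * (`|x| ^+ 2 + 2 * inner x y + `|y| ^+ 2) := hp.
have {}hm : `|J - l * (`|x| ^+ 2 - 2 * inner x y + `|y| ^+ 2)| <=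
    c * (`|x| ^+ 2 - 2 * inner x y + `|y| ^+ 2) := hm.
move: hp hm; move: I J (`|x| ^+ 2) (`|y| ^+ 2) (inner x y) => I J X Y p.
rewrite !ler_norml => /andP[h1 h2] /andP[h3 h4]; apply/andP; split; lra.
Qed.

(** The spectral measures of x + y and x - y coincide when x and y lie in
    orthogonal spectral subspaces, and they cancel in the polarized integral. *)
Lemma op_form_orth x y a b : a <= b -> P a b x = x -> op_dom A y ->
  P a b y = 0 -> inner (A x) y = 0.
Proof.
move=> ab Px dy Py.
have dx : op_dom A x by rewrite -Px; exact: spec_proj_dom.
rewrite EA.2// /sf_integral.
have e l : sf_distr E (x + y) l = sf_distr E (x - y) l.
  rewrite !sf_distrE (linearD (E _)) (linearB (E _)).
  rewrite (inner_normD (E l x)) (inner_normB (E l x)).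
  suff -> : inner (E l x) (E l y) = 0 by ring.
  rewrite -{1}Px (sf_sym E) (sf_projM E) spec_proj_sym spec_projC Py.
  by rewrite linear0 inner0r.
rewrite -[X in 4^-1 * (X - _)](_ : \int[mu (x - y)]_l id l = _); last first.
  congr fine; apply: eq_measure_integral => D mD _; exact: sf_measure_eq.
by rewrite subrr mulr0.
Qed.

Hypothesis A_dense : dense (op_dom A).

Lemma dense_seq x : exists u : nat -> H, (forall n, op_dom A (u n)) /\
  u n @[n --> \oo] --> x.
Proof.
have h (n : nat) : exists y, op_dom A y /\ ball x n.+1%:R^-1 y.
  have [||y [xy dy]] := A_dense (O := (ball x n.+1%:R^-1)).
  - by exists x; exact: ballxx.
  - exact: ball_open.
  - by exists y.
have [u uP] := choice h.
exists u; split; first by move=> n; have [] := uP n.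
apply/cvgrPdist_le => e e0.
near=> n; have [_] := uP n; rewrite -ball_normE/= => /ltW/le_trans; apply.
by apply/ltW; near: n; exact: (near_infty_natSinv_lt (PosNum e0)).
Unshelve. all: by end_near. Qed.

(** The bound of [op_form_near] on the bilinear form controls the norm of
    A x - l x once the test vector may be arbitrary: replacing a test vector by
    its projection to the range of P changes nothing, by [op_form_orth], the
    domain is dense, and the best test vector is (A x - l x) / c. *)
Lemma op_near_scalar x a b l c : a <= b -> P a b x = x -> 0 < c ->
  (forall t, a < t <= b -> `|t - l| <= c) -> `|A x - l *: x| <= c * `|x|.
Proof.
move=> ab Px c0 lc.
set z := A x - l *: x.
have h y : op_dom A y -> inner z y <= 2^-1 * c * (`|x| ^+ 2 + `|y| ^+ 2).
  move=> dy; have dPy := spec_proj_dom y ab.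
  have zy : inner z y = inner z (P a b y).
    apply/eqP; rewrite -subr_eq0 -innerBr innerBl.
    have Py0 : P a b (y - P a b y) = 0 by rewrite spec_projB spec_proj_id// subrr.
    rewrite (op_form_orth ab Px _ Py0); last exact: op_domB.
    by rewrite innerZl -Px spec_proj_sym Py0 inner0r mulr0 subrr.
  have := op_form_near ab Px (spec_proj_id E y ab) lc.
  rewrite zy innerBl innerZl ler_norml => /andP[_ /le_trans]; apply.
  rewrite ler_wpM2l//; first by rewrite mulr_ge0// ltW.
  by rewrite lerD2l ler_pXn2r ?nnegrE// norm_spec_proj_le.
have hh y : inner z y <= 2^-1 * c * (`|x| ^+ 2 + `|y| ^+ 2).
  have [u [du uy]] := dense_seq y.
  have c1 : inner z (u n) @[n --> \oo] --> inner z y.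
    by apply: cvg_inner => //; exact: cvg_cst.
  have c2 : 2^-1 * c * (`|x| ^+ 2 + `|u n| ^+ 2) @[n --> \oo] -->
      2^-1 * c * (`|x| ^+ 2 + `|y| ^+ 2).
    apply: cvgMl_tmp; apply: cvgD; first exact: cvg_cst.
    have un : `|u n| @[n --> \oo] --> `|y| by exact: cvg_norm.
    by under eq_fun do rewrite expr2; rewrite expr2; apply: cvgM; exact: un.
  apply: (ler_cvg_to c1 c2).
  by apply: nearW => n; exact: h.
(* This test vector optimizes the bound, which is not homogeneous in y. *)
have := hh (c^-1 *: z).
rewrite innerZr inner_norm normrZ gtr0_norm ?invr_gt0// exprMn.
move: `|x| `|z| (normr_ge0 x) (normr_ge0 z) => X Z X0 Z0 h'.
have cX : 0 <= c * X by rewrite mulr_ge0// ltW.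
rewrite -(@ler_pXn2r _ 2) ?nnegrE//.
have : c * (c^-1 * Z ^+ 2) <= c * (2^-1 * c * (X ^+ 2 + c^-1 ^+ 2 * Z ^+ 2)).
  by rewrite ler_pM2l.
have -> : c * (c^-1 * Z ^+ 2) = Z ^+ 2 by field; rewrite gt_eqF.
have -> : c * (2^-1 * c * (X ^+ 2 + c^-1 ^+ 2 * Z ^+ 2)) =
  2^-1 * (c * X) ^+ 2 + 2^-1 * Z ^+ 2 by field; rewrite gt_eqF.
lra.
Qed.

End spectral_operator.

(** * Discreteness of the spectrum *)

(** Cousin's covering argument: let c increase from a to b as long as Q a c
    holds; the local hypothesis at the supremum of these c carries the property
    beyond it. *)
Lemma cousin (R : realType) (Q : R -> R -> Prop) (a b : R) : a < b ->
  (forall x y z, x < y -> y < z -> Q x y -> Q y z -> Q x z) ->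
  (forall l, a <= l <= b -> exists2 e : R, 0 < e &
    forall x y, l - e < x -> x < y -> y < l + e -> Q x y) ->
  Q a b.
Proof.
move=> ab Qcat Qloc.
pose S := [set c | [/\ a < c, c <= b & Q a c]].
have S0 : S !=set0.
  have [|e e0 Qe] := Qloc a; first by rewrite lexx ltW.
  exists (Num.min b (a + e / 2)); split.
  - by rewrite lt_min ab ltrDl divr_gt0.
  - by rewrite ge_min lexx.
  - apply: Qe.
    + by rewrite gtrBl.
    + by rewrite lt_min ab ltrDl divr_gt0.
    + by rewrite gt_min; apply/orP; right; lra.
have Sb : ubound S b by move=> c [].
have hS : has_sup S by split => //; exists b.
have supb : sup S <= b by exact: ge_sup.
have [c0 Sc0] := S0.
have asup : a < sup S.
  by have [ac0 _ _] := Sc0; apply: (lt_le_trans ac0); apply: ub_le_sup => //; exists b.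
have [|e e0 Qe] := Qloc (sup S); first by rewrite supb ltW.
have [c [ac cb Qac] ce] := sup_adherent e0 hS.
have cS : c <= sup S by apply: ub_le_sup; [exists b|split].
(* A point of S beyond sup S, unless b is reached first. *)
pose d := Num.min b (sup S + e / 2).
have db : d <= b by rewrite /d ge_min lexx.
have de : d < sup S + e by rewrite /d gt_min; apply/orP; right; lra.
have [cd|dc] := ltP c d.
  have Qad : Q a d by apply: (Qcat _ c) => //; exact: Qe.
  have dS : d <= sup S.
    by apply: ub_le_sup; [exists b|split => //; exact: lt_trans cd].
  suff <- : d = b by [].
  move: dS; rewrite /d; case: (leP b (sup S + e / 2)) => //; lra.
suff <- : c = b by [].
apply/eqP; rewrite eq_le cb/=; move: dc; rewrite /d ge_min => /orP[//|]; lra.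
Qed.

Section discrete.
Context (R : realType) (H : innerProductType R) (E : spectral_family H).
Context (A : operator H) (EA : resolution_of E A).
Hypothesis A_dense : dense (op_dom A).
Implicit Types (x y z w : H) (a b c l m s t : R) (F : R -> R).
Local Notation P := (spec_proj E).
Local Notation mu := (sf_measure E).

(** On the range of P_]a,b], with ]a, b] inside a ball of radius 1 / (2M)
    around l, A - l has norm at most 1 / (2M), while its inverse has norm at
    most M: this range is zero. *)
Lemma resolvent_locally_cst l : resolvent_set A l ->
  exists2 e : R, 0 < e &
    forall a b, l - e < a -> a < b -> b < l + e -> forall x, E a x = E b x.
Proof.
move=> [B [/linear_bounded_continuous/linear_boundedP/pinfty_ex_gt0 [M M0 BM] _ BA]].
exists (2 * M)^-1; first by rewrite invr_gt0 mulr_gt0.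
set e := (2 * M)^-1 => a b la ab bl x.
have e0 : 0 < e by rewrite invr_gt0 mulr_gt0.
suff Pab0 : P a b x = 0 by apply/esym/subr0_eq.
set y := P a b x.
have Py : P a b y = y by apply: spec_proj_id; exact: ltW.
have dy : op_dom A y by apply: (spec_proj_dom EA); exact: ltW.
have h : `|A y - l *: y| <= e * `|y|.
  apply: (op_near_scalar EA A_dense (ltW ab) Py e0) => t /andP[t1 t2].
  by rewrite ler_norml; apply/andP; split; lra.
apply/eqP; rewrite -normr_le0 -/y.
have : `|y| <= 2^-1 * `|y|.
  rewrite -{1}(BA y dy); apply: (le_trans (BM _)).
  apply: (le_trans (ler_wpM2l (ltW M0) h)).
  by rewrite mulrA /e invfM mulrCA divff ?mulr1// gt_eqF.
lra.
Qed.

Hypothesis A_discrete : discrete_spectrum A.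

Lemma resolvent_range_cst a b : a < b ->
  (forall l, a <= l <= b -> resolvent_set A l) -> forall x, E a x = E b x.
Proof.
move=> ab rab; apply: (@cousin _ (fun a b => forall x, E a x = E b x)) => //.
  by move=> x y z _ _ xy yz w; rewrite xy.
by move=> l /rab/resolvent_locally_cst.
Qed.

(** Near a point of the spectrum all other points are in the resolvent set,
    so that E can only jump at l itself. *)
Lemma locally_cst_punctured l : exists2 e : R, 0 < e &
  (forall a b, l - e < a -> a < b -> b < l -> forall x, E a x = E b x) /\
  (forall a b, l < a -> a < b -> b < l + e -> forall x, E a x = E b x).
Proof.
have [rl|/A_discrete[+ _ _]] := pselect (resolvent_set A l).
  have [e e0 le] := resolvent_locally_cst rl.
  by exists e => //; split=> a b h1 h2 h3; apply: le => //; lra.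
move=> /nbhs_ballP[e /= e0 er]; exists e => //.
have res m : `|l - m| < e -> m != l -> resolvent_set A m.
  by move=> lm ml; apply: contrapT => sm; exact: (er m lm ml).
split=> a b h1 h2 h3; apply: resolvent_range_cst => // m /andP[am mb].
  apply: res; last by rewrite lt_eqF//; lra.
  by rewrite ltr_norml; apply/andP; split; lra.
apply: res; last by rewrite gt_eqF//; lra.
by rewrite ltr_norml; apply/andP; split; lra.
Qed.

(** By right continuity, a jump at l is already included in E l. *)
Lemma right_cst l b : l < b ->
  (forall t, l < t -> t < b -> forall x, E t x = E b x) ->
  forall x, E l x = E b x.
Proof.
move=> lb lbE x.
have c1 : E t x @[t --> l^'+] --> E l x by exact: sf_right_continuous.
have c2 : E t x @[t --> l^'+] --> E b x.
  apply: cvg_near_cst; near=> t; apply: lbE; near: t.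
    exact: nbhs_right_gt.
  exact: nbhs_right_lt.
exact: (cvg_unique _ c1 c2).
Unshelve. all: by end_near. Qed.

(** On an atom the spectral measure can only charge the point s. Such a point
    is included even when E does not jump there, so that every short interval is
    an atom. *)
Definition atom a s b := [/\ a < s, s <= b,
  forall t, a <= t -> t < s -> forall x, E t x = E a x &
  forall t, s <= t -> t <= b -> forall x, E t x = E b x].

(** If l belongs to ]a, b] then s = l; otherwise E is constant on [a, b] and
    the choice s = b is as good as any other. *)
Lemma locally_atom l : exists2 e : R, 0 < e &
  forall a b, l - e < a -> a < b -> b < l + e -> exists s, atom a s b.
Proof.
have [e e0 [eL eR]] := locally_cst_punctured l.
have eR' a b : l <= a -> a < b -> b < l + e -> forall x, E a x = E b x.
  rewrite le_eqVlt => /predU1P[<-|la] h2 h3; last exact: eR.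
  by apply: right_cst => // t lt tb; exact: eR.
exists e => // a b la ab bl.
have [la'|al] := leP l a.
  exists b; split => //.
    move=> t; rewrite le_eqVlt => /predU1P[->//|at_] tb x.
    by apply/esym/eR' => //; lra.
  by move=> t bt tb x; congr (E _ x); lra.
have [bl'|lb] := ltP b l.
  exists b; split => //.
    move=> t; rewrite le_eqVlt => /predU1P[->//|at_] tb x.
    by apply/esym/eL => //; lra.
  by move=> t bt tb x; congr (E _ x); lra.
exists l; split => //.
  move=> t; rewrite le_eqVlt => /predU1P[->//|at_] tl x.
  by apply/esym/eL => //; lra.
move=> t lt; rewrite le_eqVlt => /predU1P[->//|tb] x.
exact: eR'.
Qed.

Lemma atom_ind (Q : R -> R -> Prop) :
  (forall a b c, a < b -> b < c -> Q a b -> Q b c -> Q a c) ->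
  (forall a s b, atom a s b -> Q a b) ->
  forall a b, a < b -> Q a b.
Proof.
move=> Qcat Qatom a b ab; apply: cousin => // l _.
have [e e0 le] := locally_atom l; exists e => // c d h1 h2 h3.
by have [s /Qatom] := le _ _ h1 h2 h3.
Qed.

Lemma atom_lt a s b : atom a s b -> a < b.
Proof. by move=> [h1 h2 _ _]; exact: lt_le_trans h2. Qed.

(** The range of P_]a,b] is also that of P_]a',s] for every a' in [a, s[, and
    [op_near_scalar] applies with a bound s - a' that is as small as desired. *)
Lemma atom_eigen a s b x : atom a s b ->
  op_dom A (P a b x) /\ A (P a b x) = s *: P a b x.
Proof.
move=> abs; have ab := ltW (atom_lt abs); have [as_ sb aE bE] := abs.
split; first exact: (spec_proj_dom EA).
set y := P a b x.
have small c : 0 < c -> `|A y - s *: y| <= c * `|y|.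
  move=> c0; pose a' := Num.max a (s - c).
  have aa' : a <= a' by rewrite /a' le_max lexx.
  have a's : a' < s by rewrite /a' gt_max as_/= gtrBl.
  have ca' : s - c <= a' by rewrite /a' le_max lexx orbT.
  have yE : y = P a' s x by rewrite /y /spec_proj -(bE s)// (aE a').
  apply: (op_near_scalar EA A_dense (ltW a's)) => //.
    by rewrite yE spec_proj_id// ltW.
  by move=> t /andP[t1 t2]; rewrite ler_norml; apply/andP; split; lra.
apply/eqP; rewrite -subr_eq0 -normr_le0; apply/ler_addgt0Pl => c c0.
have y1 : 0 < `|y| + 1 by rewrite ltr_wpDl.
have := small _ (divr_gt0 c0 y1); rewrite addr0 => /le_trans; apply.
by rewrite mulrAC ler_pdivrMr// ler_pM2l// lerDl.
Qed.

Hypothesis A_positive : op_positive A.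

Lemma atom_gt0 a s b x : atom a s b -> P a b x != 0 -> 0 < s.
Proof.
move=> abs y0; have [dy Ay] := atom_eigen x abs.
have := A_positive dy y0; rewrite Ay innerZl inner_norm.
by rewrite pmulr_lgt0// exprn_gt0// normr_gt0.
Qed.

Lemma atom_eigenvalue a s b x : atom a s b -> P a b x != 0 ->
  op_eigenvalue A s.
Proof. by move=> abs y0; have [dy Ay] := atom_eigen x abs; exists (P a b x). Qed.

(** An atom to the left of 0 carries no vector, since its point would be a
    nonpositive eigenvalue. *)
Lemma spec_nonpos x : E 0 x = 0.
Proof.
have P0 a b : a < b -> b <= 0 -> forall x, P a b x = 0.
  apply: (@atom_ind (fun a b => b <= 0 -> forall x, P a b x = 0)).
    move=> u v w uv vw huv hvw w0 y.
    by rewrite (spec_proj_cat E u v w) huv ?hvw ?addr0// ltW// (lt_le_trans vw).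
  move=> u s v uv v0 y; apply/eqP/negPn/negP => /(atom_gt0 uv).
  by have [_ sv _ _] := uv; lra.
have c1 : E l x @[l --> -oo] --> (0 : H) by exact: sf_cvgNy.
have c2 : E l x @[l --> -oo] --> E 0 x.
  apply: cvg_near_cst; near=> l.
  have l0 : l < 0 by near: l; exact: nbhs_ninfty_lt.
  by apply/esym/subr0_eq; exact: (P0 l 0).
exact: (cvg_unique _ c2 c1).
Unshelve. all: by end_near. Qed.

Lemma sf_distr_nonpos x l : l <= 0 -> sf_distr E x l = 0.
Proof.
move=> l0; have := sf_distr_nondecreasing E x l0.
rewrite [X in _ <= X]sf_distrE spec_nonpos normr0 expr0n/= => h.
by apply/eqP; rewrite eq_le h sf_distrE sqr_ge0.
Qed.

Lemma sf_measure_nonpos x : (mu x).-negligible (`]-oo, 0]%classic : set R).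
Proof.
have : (mu x).-negligible (\bigcup_n `]((- n%:R)%R : R), 0]%classic).
  apply: negligible_bigcup => k; apply/negligibleP; first exact: measurable_itv.
  have k0 : - k%:R <= 0 :> R by rewrite oppr_le0.
  by rewrite -[LHS]/(mu x _) sf_measure_ocitv// !sf_distr_nonpos// subrr.
apply: negligibleS => t /=; rewrite in_itv/= => t0; exists (Num.bound `|t|) => //=.
rewrite in_itv/= t0 andbT; have := archi_boundP (normr_ge0 t).
by rewrite ltr_norml => /andP[].
Qed.

(** The Sobolev norm only integrates over the nonnegative frequencies, while
    the domain of A refers to the whole line; the difference is the mass of the
    nonpositive half-line, which is zero. *)
Lemma sobolev1_dom x : sobolev E 1 x -> op_dom A x.
Proof.
move=> sx; apply/(EA.1 _).2; apply: le_lt_trans sx.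
have mI : measurable (`[0, +oo[%classic : set (measurableTypeR R)).
  exact: measurable_itv.
rewrite /sobolev_sqr [leRHS]integral_mkcond.
have mf : measurable_fun setT (fun l : measurableTypeR R => ((1 + l ^+ 2) `^ 1)%:E).
  apply/measurable_EFinP; under eq_fun do rewrite powRr1 ?addr_ge0 ?sqr_ge0//.
  by apply: measurable_funD => //; exact: measurable_funX.
apply: ae_ge0_le_integral => //.
- by move=> l _; rewrite lee_fin sqr_ge0.
- by apply/measurable_EFinP; exact: measurable_funX.
- by move=> l _; rewrite patchE; case: ifP => // _; rewrite lee_fin powR_ge0.
- by apply/(measurable_restrictT _ mI); exact: measurable_funTS.
- apply: (negligibleS _ (sf_measure_nonpos x)).
  move=> l /= nl; rewrite in_itv/= leNgt; apply/negP => l0; apply: nl => _.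
  rewrite patchE mem_set/= ?in_itv/= ?andbT ?(ltW l0)//.
  by rewrite powRr1 ?addr_ge0 ?sqr_ge0// lee_fin lerDr.
Qed.

End discrete.

(** * Functions of the operator *)

Section calculus.
Context (R : realType) (H : innerProductType R) (E : spectral_family H).
Context (A : operator H) (EA : resolution_of E A).
Hypothesis A_dense : dense (op_dom A).
Hypothesis A_discrete : discrete_spectrum A.
Hypothesis A_positive : op_positive A.
Hypothesis H_complete : seq_complete H.
Implicit Types (x y z w : H) (a b c l m s t : R).
Local Notation P := (spec_proj E).
Local Notation mu := (sf_measure E).

Variables (F : R -> R) (M : R).
Hypothesis cF : continuous F.
Hypothesis FM : forall l, `|F l| <= M.

Let mF : measurable_fun setT F.
Proof. exact: continuous_measurable_fun. Qed.

Let M0 : 0 <= M.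
Proof. exact: le_trans (FM 0). Qed.

(** The interval ]a, b] can be shrunk to ]a', s] with a' close to s without
    changing the integral, and F is almost equal to F s there. *)
Lemma atom_integral w a s b : atom E a s b ->
  itv_integral E F w a b = F s * (sf_distr E w b - sf_distr E w a).
Proof.
move=> abs; have [as_ sb aE bE] := abs; set D := sf_distr E w b - _.
have D0 : 0 <= D.
  by rewrite subr_ge0 sf_distr_nondecreasing// ltW// (atom_lt abs).
have dsb : sf_distr E w s = sf_distr E w b by rewrite !sf_distrE (bE s).
have close e : 0 < e -> `|itv_integral E F w a b - F s * D| <= e * D.
  move=> e0; have Fs : F t @[t --> s] --> F s by exact: cF.
  have /cvgrPdist_le/(_ e e0) := Fs.
  move=> /nbhs_ballP[d /= d0 Fd].
  pose a' := Num.max a (s - d).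
  have aa' : a <= a' by rewrite /a' le_max lexx.
  have a's : a' < s by rewrite /a' gt_max as_/= gtrBl.
  have da' : s - d <= a' by rewrite /a' le_max lexx orbT.
  have daa' : sf_distr E w a = sf_distr E w a' by rewrite !sf_distrE (aE a').
  rewrite (@itv_integral_cat _ _ _ F M mF FM w a s b) ?(ltW as_)//.
  rewrite (@itv_integral_null _ _ _ F M mF FM w s b)// addr0.
  rewrite (@itv_integral_cat _ _ _ F M mF FM w a a' s) ?(ltW a's)//.
  rewrite (@itv_integral_null _ _ _ F M mF FM w a a')// add0r.
  rewrite /D -dsb daa'; apply: itv_integral_near => //; first exact: ltW.
  move=> t /andP[t1]; rewrite le_eqVlt => /predU1P[->|t2].
    by rewrite subrr normr0 ltW.
  rewrite distrC; apply: Fd; rewrite /ball/= ltr_norml; apply/andP; split; lra.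
apply/eqP; rewrite -subr_eq0 -normr_le0; apply/ler_addgt0Pl => e e0.
have D1 : 0 < D + 1 by rewrite ltr_wpDl.
have := close _ (divr_gt0 e0 D1); rewrite addr0 => /le_trans; apply.
by rewrite mulrAC ler_pdivrMr// ler_pM2l// lerDl.
Qed.

(** z is the part that F(A) x has in the spectral subspace of ]a, b]. The
    bound on the norm is what makes these parts Cauchy as ]a, b] grows. *)
Definition local_apply x a b z := [/\ P a b z = z,
  forall y, inner z y =
    4^-1 * (itv_integral E F (x + y) a b - itv_integral E F (x - y) a b) &
  `|z| <= M * `|P a b x|].

Lemma local_apply_uniq x a b z w :
  local_apply x a b z -> local_apply x a b w -> z = w.
Proof. by move=> [_ zE _] [_ wE _]; apply: inner_ext => y; rewrite zE wE. Qed.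

Lemma local_apply_atom x a s b : atom E a s b ->
  local_apply x a b (F s *: P a b x).
Proof.
move=> abs; have ab := ltW (atom_lt abs); split.
- by rewrite spec_projZ spec_proj_id.
- move=> y; rewrite !(atom_integral _ abs) -!sqr_norm_spec_proj//.
  rewrite spec_projD spec_projB.
  rewrite (inner_normD (P a b x)) (inner_normB (P a b x)) innerZl.
  by rewrite [in RHS]spec_proj_sym spec_proj_id// -[in RHS]spec_proj_sym; field.
- by rewrite normrZ ler_wpM2r.
Qed.

Lemma sqr_norm_disj x y a b c : a <= b -> b <= c -> P a b x = x ->
  P b c y = y -> `|x + y| ^+ 2 = `|x| ^+ 2 + `|y| ^+ 2.
Proof.
move=> ab bc Px Py; rewrite (inner_normD x) -{2}Px spec_proj_sym -Py.
by rewrite spec_proj_disj// inner0r mulr0 addr0.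
Qed.

(** The norms add up by orthogonality. *)
Lemma local_apply_cat x a b c z w : a <= b -> b <= c ->
  local_apply x a b z -> local_apply x b c w -> local_apply x a c (z + w).
Proof.
move=> ab bc [Pz zE zM] [Pw wE wM]; split.
- rewrite spec_projD -{1}Pz -{1}Pw !spec_proj_sub ?Pz ?Pw//.
- move=> y; rewrite innerDl zE wE.
  rewrite (@itv_integral_cat _ _ _ F M mF FM (x + y) a b c ab bc).
  rewrite (@itv_integral_cat _ _ _ F M mF FM (x - y) a b c ab bc).
  by rewrite -mulrDr opprD addrACA.
- rewrite -(@ler_pXn2r _ 2) ?nnegrE ?mulr_ge0// exprMn.
  rewrite (spec_proj_cat E a b c) (sqr_norm_disj ab bc)//.
  rewrite (sqr_norm_disj ab bc) ?spec_proj_id// mulrDr -!exprMn.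
  by rewrite lerD// ler_pXn2r ?nnegrE ?mulr_ge0.
Qed.

Lemma local_apply_ex x a b : a <= b -> exists z, local_apply x a b z.
Proof.
rewrite le_eqVlt => /predU1P[<-|ab].
  have P0 y : P a a y = 0 by rewrite /spec_proj subrr.
  exists 0; split; rewrite ?P0 ?normr0 ?mulr0//.
  move=> y; rewrite !(@itv_integral_null _ _ _ F M mF FM _ a a)//.
  by rewrite inner0l subrr mulr0.
apply: (@atom_ind _ _ _ _ EA A_dense A_discrete
  (fun a b => a <= b -> exists z, local_apply x a b z)) => //; last exact: ltW.
  move=> u v w uv vw huv hvw _.
  have [|z hz] := huv; first exact: ltW.
  have [|y hy] := hvw; first exact: ltW.
  by exists (z + y); apply: local_apply_cat hz hy; exact: ltW.
by move=> u s v uv _; exists (F s *: P u v x); exact: local_apply_atom.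
Qed.

(** The nonpositive frequencies carry no mass, so that intervals starting at
    0 exhaust the line: parts of F(A) x then only have to be glued on one side. *)
Lemma cvg_integral_pos w :
  itv_integral E F w 0 n.+1%:R @[n --> \oo] --> \int[mu w]_l F l.
Proof.
have e n : itv_integral E F w (- n%:R) n%:R = itv_integral E F w 0 n%:R.
  have n0 : 0 <= n%:R :> R by [].
  rewrite (@itv_integral_cat _ _ _ F M mF FM _ _ 0) ?oppr_le0//.
  rewrite (@itv_integral_null _ _ _ F M mF FM) ?add0r ?oppr_le0//.
  by rewrite !(sf_distr_nonpos EA A_dense A_discrete A_positive) ?oppr_le0.
have := @cvg_itv_integral _ _ E F M mF FM w; rewrite (eq_cvg _ _ e).
by rewrite -(cvg_shiftS (fun n => itv_integral E F w 0 n%:R)).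
Qed.

(** F(A) x is the limit of its parts on ]0, n]. The part on an atom does not
    depend on n once ]0, n] contains this atom, which gives the second claim. *)
Lemma apply_ex x : exists z, (forall y, inner z y = sf_integral E F x y) /\
  forall a s b, 0 <= a -> atom E a s b -> P a b z = F s *: P a b x.
Proof.
have n0 (n : nat) : 0 <= n.+1%:R :> R by [].
have [z zP] := choice (fun n => local_apply_ex x (n0 n)).
have cx : E n.+1%:R x @[n --> \oo] --> x.
  have := cvg_comp _ (fun l => E l x) (@cvgr_idn R) (@sf_cvgy _ _ E x).
  by rewrite -(cvg_shiftS (fun n => E n%:R x)).
have [w zw] : exists w : H, z n @[n --> \oo] --> w.
  apply: H_complete => e e0.
  have eM : 0 < e / (2 * (M + 1)) by rewrite divr_gt0// mulr_gt0// ltr_wpDl.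
  have /cvgrPdist_le/(_ _ eM)[N _ NE] := cx.
  exists N => n Nn.
  have Nn' : N.+1%:R <= n.+1%:R :> R by rewrite ler_nat.
  have [v vP] := local_apply_ex x Nn'.
  have -> : z n = z N + v.
    apply: (local_apply_uniq (zP n)); exact: local_apply_cat (zP N) vP.
  rewrite addrC addKr; have [_ _ /le_trans] := vP; apply.
  have h : `|P N.+1%:R n.+1%:R x| <= e / (M + 1).
    have -> : P N.+1%:R n.+1%:R x = (x - E N.+1%:R x) - (x - E n.+1%:R x).
      by rewrite /spec_proj opprB [RHS]addrC subrKA.
    rewrite (le_trans (ler_normB _ _))//.
    have -> : e / (M + 1) = e / (2 * (M + 1)) + e / (2 * (M + 1)).
      by field; rewrite gt_eqF// ltr_wpDl.
    by rewrite lerD// NE/=.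
  apply: (le_trans (ler_wpM2l M0 h)).
  by rewrite mulrA ler_pdivrMr ?ltr_wpDl// mulrDr mulr1 [e * M]mulrC lerDl ltW.
exists w; split.
  move=> y.
  have c1 : inner (z n) y @[n --> \oo] --> inner w y.
    by apply: cvg_inner => //; exact: cvg_cst.
  have c2 : inner (z n) y @[n --> \oo] --> sf_integral E F x y.
    have e n : inner (z n) y = 4^-1 * (itv_integral E F (x + y) 0 n.+1%:R -
        itv_integral E F (x - y) 0 n.+1%:R) by have [] := zP n.
    rewrite (eq_cvg _ _ e); apply: cvgMl_tmp.
    by apply: cvgB; exact: cvg_integral_pos.
  exact: (cvg_unique _ c1 c2).
move=> a s b a0 abs; have ab := ltW (atom_lt abs).
have c1 : P a b (z n) @[n --> \oo] --> P a b w by exact: cvg_spec_proj.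
have c2 : P a b (z n) @[n --> \oo] --> F s *: P a b x.
  apply: cvg_near_cst; near=> n.
  have bn : b <= n.+1%:R.
    apply: (@le_trans _ _ n%:R); last by rewrite ler_nat.
    by near: n; exact: nbhs_infty_ger.
  have [u uP] := local_apply_ex x a0.
  have [v vP] := local_apply_ex x bn.
  have wP := local_apply_atom x abs.
  have -> : z n = u + F s *: P a b x + v.
    apply: (local_apply_uniq (zP n)).
    apply: (local_apply_cat _ bn _ vP); first exact: le_trans ab.
    exact: local_apply_cat uP wP.
  have [Pu _ _] := uP; have [Pv _ _] := vP; have [Pw _ _] := wP.
  rewrite !spec_projD -Pu -Pv Pw (spec_proj_disjr E _ a0)// (spec_proj_disj E _ ab)//.
  by rewrite add0r addr0.
exact: (cvg_unique _ c1 c2).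
Unshelve. all: by end_near. Qed.

(** The vector selected by [sf_apply] is the one of [apply_ex], as a vector is
    determined by its matrix coefficients. *)
Lemma sf_apply_atom x a s b : 0 <= a -> atom E a s b ->
  P a b (sf_apply E F x) = F s *: P a b x.
Proof.
move=> a0 abs; have [z [zE zatom]] := apply_ex x.
suff -> : sf_apply E F x = z by exact: zatom.
have /= h : forall y, inner (sf_apply E F x) y = sf_integral E F x y.
  exact: (@xgetPex _ 0 [set z | forall y, inner z y = sf_integral E F x y]
    (ex_intro _ z zE)).
by apply: inner_ext => y; rewrite h zE.
Qed.

End calculus.

(** * Harmonic oscillators *)

Section scalar_oscillator.
Context (R : realType).
Implicit Types (a b : R -> R) (s t T : R).

(** At an interior point, difference quotients relative to [0, T] and relative
    to the line have the same limit. *)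
Lemma is_derive_within a T t L : t \in `]0, T[ ->
  (r - t)^-1 * (a r - a t) @[r --> within `[0, T] t^'] --> L ->
  is_derive t (1 : R) a L.
Proof.
rewrite in_itv/= => /andP[t0 tT] aL.
have c : h^-1 *: (a (h *: 1 + t) - a t) @[h --> 0^'] --> L.
  apply/cvgrPdist_le => e e0; move/cvgrPdist_le: aL => /(_ e e0).
  move=> /nbhs_ballP[d /= d0 dP].
  pose m := Num.min d (Num.min t (T - t)).
  have m0 : 0 < m by rewrite !lt_min d0 t0 subr_gt0.
  apply/nbhs_ballP; exists m => //= h; rewrite /ball/= sub0r normrN => hm h0.
  have [hd [ht hTt]] : `|h| < d /\ `|h| < t /\ `|h| < T - t.
    by move: hm; rewrite !lt_min => /andP[-> /andP[-> ->]].
  rewrite -[h *: 1]/(h * 1) mulr1.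
  have := dP (h + t); rewrite /ball/= opprD addrCA subrr addr0 normrN => /(_ hd).
  rewrite addrK; apply.
    by apply: contra_neq h0 => /eqP; rewrite -subr_eq0 addrK => /eqP.
  move: ht hTt; rewrite !ltr_norml => /andP[h1 h2] /andP[h3 h4].
  by rewrite in_itv/=; apply/andP; split; lra.
have c' : h^-1 *: ((a \o shift t) (h *: 1) - a t) @[h --> 0^'] --> L by [].
by apply: DeriveDef; [exact: cvgP c'|exact: cvg_lim c'].
Qed.

Lemma cvg_of_quotient (G : set_system R) {FG : Filter G} a t (L : R) :
  r @[r --> G] --> t -> (\forall r \near G, r != t) ->
  (r - t)^-1 * (a r - a t) @[r --> G] --> L -> a r @[r --> G] --> a t.
Proof.
move=> Gt Gn aL.
have idt : r - t @[r --> G] --> (0 : R).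
  by rewrite -(subrr t); apply: cvgB => //; exact: cvg_cst.
have c : (r - t) * ((r - t)^-1 * (a r - a t)) + a t @[r --> G] --> 0 * L + a t.
  by apply: cvgD; [apply: cvgM|exact: cvg_cst].
rewrite mul0r add0r in c; apply: cvg_trans c.
apply: near_eq_cvg; apply: filterS Gn => r rt.
have rt0 : r - t != 0 by rewrite subr_eq0.
by rewrite mulrA divff// mul1r subrK.
Qed.

Lemma continuous_within_quotient a T t (L : R) :
  (r - t)^-1 * (a r - a t) @[r --> within `[0, T] t^'] --> L ->
  a r @[r --> within `[0, T] (nbhs t)] --> a t.
Proof.
move=> aL.
have ca : a r @[r --> within `[0, T] t^'] --> a t.
  apply: (@cvg_of_quotient _ (within_filter _ _) _ _ L) => //.
    by apply: cvg_within_filter; exact: nbhs_dnbhs.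
  by rewrite nearE /within/=; apply: filterS (nbhs_dnbhs_neq t) => r rt _.
apply/cvgrPdist_le => e e0; move/cvgrPdist_le: ca => /(_ e e0).
move=> h.
have {}h : nbhs t (fun r => r != t -> `[0, T]%classic r -> `|a t - a r| <= e).
  by [].
suff : nbhs t (fun r => `[0, T]%classic r -> `|a t - a r| <= e) by [].
apply: filterS h => r h rT.
have [->|rt] := eqVneq r t; first by rewrite subrr normr0 ltW.
exact: h.
Qed.

(** For a'' = - s^2 a, the quantity
    s a(t) cos (s (T - t)) + a'(t) sin (s (T - t)) is conserved; its values at 0
    and T are the two sides. Multiplying by s avoids dividing by it. *)
Lemma oscillator a b s T : 0 < T ->
  (forall t, t \in `]0, T[ -> is_derive t (1 : R) a (b t)) ->
  (forall t, t \in `]0, T[ -> is_derive t (1 : R) b (- (s ^+ 2 * a t))) ->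
  (forall t, t \in `[0, T] -> a r @[r --> within `[0, T] (nbhs t)] --> a t) ->
  (forall t, t \in `[0, T] -> b r @[r --> within `[0, T] (nbhs t)] --> b t) ->
  s * a T = s * a 0 * cos (s * T) + b 0 * sin (s * T).
Proof.
move=> T0 da db ca cb.
pose w t := s * (T - t).
pose h t := s * a t * cos (w t) + b t * sin (w t).
have dw t : is_derive t (1 : R) w (- s).
  have -> : w = cst (s * T) - s \*: (id : R -> R).
    by apply/funext => r; rewrite /w mulrBr.
  by apply: is_derive_eq; rewrite sub0r -[s *: 1]/(s * 1) mulr1.
have cw t : w r @[r --> t] --> w t.
  apply: (@differentiable_continuous _ _ _ t w).
  exact/derivable1_diffP.
have dh t : t \in `]0, T[ -> is_derive t (1 : R) h 0.
  move=> tT; have dat := da _ tT; have dbt := db _ tT; have dwt := dw t.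
  have dc : is_derive t (1 : R) (cos \o w) (- sin (w t) * - s).
    exact: is_derive1_comp.
  have ds : is_derive t (1 : R) (sin \o w) (cos (w t) * - s).
    exact: is_derive1_comp.
  have -> : h = (s \*: a) * (cos \o w) + b * (sin \o w).
    by apply/funext.
  have dsum := is_deriveD (is_deriveM (is_deriveZ s dat) dc) (is_deriveM dbt ds).
  apply: (is_derive_eq dsum).
  rewrite /= -![_ *: _]/(_ * _); ring.
have ch : {within `[0, T], continuous h}.
  apply/subspace_continuousP => t tT.
  have cc : cos (w r) @[r --> within `[0, T] (nbhs t)] --> cos (w t).
    apply: cvg_within_filter; apply: (continuous_cvg _ _ (cw t)).
    exact: continuous_cos.
  have cs : sin (w r) @[r --> within `[0, T] (nbhs t)] --> sin (w t).
    apply: cvg_within_filter; apply: (continuous_cvg _ _ (cw t)).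
    exact: continuous_sin.
  apply: cvgD; last by apply: cvgM => //; exact: cb.
  by apply: cvgM => //; apply: cvgMl_tmp; exact: ca.
have [c _] := MVT T0 dh ch.
rewrite mul0r => /eqP; rewrite subr_eq0 => /eqP.
by rewrite /h /w subrr mulr0 cos0 sin0 mulr1 mulr0 addr0 subr0.
Qed.

(** Reduce x modulo pi to [0, pi[, where the sine vanishes only at 0. *)
Lemma sin_eq0_pos (x : R) : 0 < x -> sin x = 0 ->
  exists2 k : nat, (0 < k)%N & x = k%:R * pi.
Proof.
move=> x0 sx; have pi0 := pi_gt0 R.
have xpi : 0 <= x / pi by rewrite divr_ge0 ?ltW.
have /andP[k1 k2] := truncn_itv xpi.
set k := Num.truncn (x / pi) in k1 k2.
pose y := x - pi *+ k.
have xy : x = y + pi *+ k by rewrite subrK.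
have y0 : 0 <= y by rewrite subr_ge0 -mulr_natl -ler_pdivlMr.
have ypi : y < pi.
  by rewrite ltrBlDr -mulrS -mulr_natl -ltr_pdivrMr.
have sy : sin y = 0.
  move: sx; rewrite xy (alternatingn (@sinDpi R)) => /eqP.
  by rewrite mulf_eq0 signr_eq0 => /eqP.
have ye : y = 0.
  apply/eqP/negPn/negP => yn; have := @sin_gt0_pi R y.
  by rewrite sy lt_def yn y0 ypi ltxx => /(_ isT).
exists k; last by rewrite xy ye add0r mulr_natl.
rewrite lt0n; apply/negP => /eqP k0.
by move: x0; rewrite xy ye k0 mulr0n addr0 ltxx.
Qed.

End scalar_oscillator.

(** * The wave equation and the iteration *)

Section wave.
Context (R : realType) (H : innerProductType R) (E : spectral_family H).
Context (A : operator H) (EA : resolution_of E A).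
Hypothesis A_self_adjoint : self_adjoint A.
Hypothesis A_discrete : discrete_spectrum A.
Hypothesis A_positive : op_positive A.
Context (T : R) (T_gt0 : 0 < T).
Implicit Types (x y z w : H) (a b c l m s t : R).
Local Notation P := (spec_proj E).

Let A_dense : dense (op_dom A) := A_self_adjoint.1.

Lemma op_sym x y : op_dom A x -> op_dom A y -> inner (A x) y = inner x (A y).
Proof. by move=> dx dy; exact: (A_self_adjoint.2 y (A y)).2. Qed.

Section solution.
Context (u : R -> H) (u_wave : wave_solution E A T u).

Lemma wave_dom t : t \in `[0, T] -> op_dom A (u t).
Proof.
have [ut _ _ _] := u_wave => /ut[ut1 _].
exact: (sobolev1_dom EA A_dense A_discrete A_positive).
Qed.

(** The coefficient of the solution along an eigenvector v is a harmonic
    oscillator of frequency s: in the weak equation, one factor s comes from A v = s v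
    and the other from the symmetry of A. *)
Lemma wave_eigen v s : op_dom A v -> A v = s *: v ->
  s * inner (u T) v = s * inner (u 0) v * cos (s * T)
    + inner (time_derive T u 0) v * sin (s * T).
Proof.
move=> dv Av; have [_ u_cvg u'_cont u_eq] := u_wave.
have quot t : t \in `[0, T] ->
    (r - t)^-1 * (inner (u r) v - inner (u t) v) @[r --> within `[0, T] t^'] -->
    inner (time_derive T u t) v.
  move=> tT.
  have e r : (r - t)^-1 * (inner (u r) v - inner (u t) v) =
      inner (diff_quotient u t r) v by rewrite innerZl innerBl.
  rewrite (eq_cvg _ _ e).
  apply: (@cvg_inner _ _ _ _ (within_filter _ _)); last first.
    by apply: (@cvg_cst _ _ _ _ (within_filter _ _)).
  exact: u_cvg.
have sub t : t \in `]0, T[ -> t \in `[0, T].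
  by apply: subset_itvW.
apply: (@oscillator R (fun t => inner (u t) v)
  (fun t => inner (time_derive T u t) v) s T T_gt0).
- by move=> t tT; apply: is_derive_within (tT) (quot _ (sub _ tT)).
- move=> t tT; apply: is_derive_eq; first exact: u_eq.
  rewrite Av innerZr op_sym//; last exact/wave_dom/sub.
  by rewrite Av innerZr; ring.
- by move=> t tT; exact: continuous_within_quotient (quot _ tT).
- move=> t tT; apply: (@cvg_inner _ _ _ _ (within_filter _ _)); last first.
    by apply: (@cvg_cst _ _ _ _ (within_filter _ _)).
  by move/subspace_continuousP: u'_cont; apply.
Qed.

(** Tested against any vector y, this is [wave_eigen] for the eigenvector
    P_]a,b] y, whose factor s is moved onto u(T) and u(0) as A, by the symmetry
    of A. *)
Lemma wave_atom a s b : atom E a s b ->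
  P a b (A (u T)) = cos (s * T) *: P a b (A (u 0)) +
    sin (s * T) *: P a b (time_derive T u 0).
Proof.
move=> abs; apply: inner_ext => y.
have [dy Ay] := atom_eigen EA A_dense y abs.
rewrite [in RHS]innerDl !innerZl !spec_proj_sym.
have T0 : 0 \in `[0, T] by rewrite in_itv/= lexx ltW.
have TT : T \in `[0, T] by rewrite in_itv/= lexx ltW.
rewrite !op_sym//; [|exact: wave_dom..].
by rewrite Ay !innerZr (wave_eigen dy Ay); ring.
Qed.

End solution.

Hypothesis H_complete : seq_complete H.
Hypothesis T_nonresonant : forall k : nat, (0 < k)%N ->
  ~ op_eigenvalue A (k%:R * pi / T).

Lemma cosA_atom x a s b : 0 <= a -> atom E a s b ->
  P a b (cosA E T x) = cos (s * T) *: P a b x.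
Proof.
apply: (@sf_apply_atom _ _ _ _ EA A_dense A_discrete A_positive H_complete
  (fun l => cos (l * T)) 1).
  move=> l; apply: continuous_comp; last exact: continuous_cos.
  by apply: cvgMr_tmp; exact: cvg_id.
by move=> l; exact: cos_max.
Qed.

Lemma sinA_atom x a s b : 0 <= a -> atom E a s b ->
  P a b (sinA E T x) = sin (s * T) *: P a b x.
Proof.
apply: (@sf_apply_atom _ _ _ _ EA A_dense A_discrete A_positive H_complete
  (fun l => sin (l * T)) 1).
  move=> l; apply: continuous_comp; last exact: continuous_sin.
  by apply: cvgMr_tmp; exact: cvg_id.
by move=> l; exact: sin_max.
Qed.

(** If cos(sT)^2 = 1 then sT is a positive multiple of pi, and s is a resonant
    eigenvalue. *)
Lemma atom_cos_lt1 x a s b : atom E a s b -> P a b x != 0 ->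
  cos (s * T) ^+ 2 < 1.
Proof.
move=> abs x0.
have s0 : 0 < s by exact: (atom_gt0 EA A_dense A_positive abs x0).
rewrite cos2sin2 gtrBl exprn_even_gt0//=.
apply/eqP => /(sin_eq0_pos (mulr_gt0 s0 T_gt0)).
move=> [k k0 sT]; apply: (T_nonresonant k0).
rewrite -sT mulfK ?gt_eqF//.
exact: (atom_eigenvalue EA A_dense abs x0).
Qed.

Section iteration.
Context (u : R -> H) (u_wave : wave_solution E A T u) (phi0 : H).

Definition iteration_error k : H :=
  iter k (iteration_map E A T (u 0) (u T)) phi0 - time_derive T u 0.

(** By [wave_atom] the terms in A f cancel, and the remaining term
    sin(sT)^2 psi = psi - cos(sT)^2 psi makes psi a fixed point. *)
Lemma iteration_error_atom k a s b : 0 <= a -> atom E a s b ->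
  P a b (iteration_error k) =
  (cos (s * T) ^+ 2) ^+ k *: P a b (iteration_error 0).
Proof.
move=> a0 abs; elim: k => [|k IHk]; first by rewrite expr0 scale1r.
rewrite exprS -scalerA -IHk /iteration_error iterS.
move: (iter k _ _) => phi.
have stepE : P a b (iteration_map E A T (u 0) (u T) phi) =
    cos (s * T) *: (cos (s * T) *: P a b phi)
    - cos (s * T) *: (sin (s * T) *: P a b (A (u 0)))
    + sin (s * T) *: P a b (A (u T)).
  rewrite /iteration_map spec_projD spec_projB; congr (_ - _ + _).
  - apply: (etrans (cosA_atom _ a0 abs)).
    exact: congr1 (cosA_atom phi a0 abs).
  - apply: (etrans (cosA_atom _ a0 abs)).
    exact: congr1 (sinA_atom (A (u 0)) a0 abs).
  - exact: sinA_atom.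
rewrite !spec_projB stepE (wave_atom u_wave abs).
move: (P a b phi) (P a b (A (u 0))) (P a b (time_derive T u 0)) => X Y Z.
rewrite scalerDr !scalerA (mulrC (sin _) (cos _)) addrA subrK.
rewrite scalerBr -!expr2 sin2cos2 scalerBl scale1r -addrA; congr (_ + _).
by rewrite addrC addKr.
Qed.

(** The squared norm of the part of the error with frequencies in ]a, b]. *)
Definition error_mass k a b :=
  sf_distr E (iteration_error k) b - sf_distr E (iteration_error k) a.

Lemma error_mass_atom k a s b : 0 <= a -> atom E a s b ->
  error_mass k a b = ((cos (s * T) ^+ 2) ^+ 2) ^+ k * error_mass 0 a b.
Proof.
move=> a0 abs; have ab := ltW (atom_lt abs).
rewrite /error_mass -!sqr_norm_spec_proj// (iteration_error_atom k a0 abs).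
rewrite normrZ exprMn ger0_norm; last by rewrite exprn_ge0// sqr_ge0.
by congr (_ * _); exact: exprAC.
Qed.

(** Both properties are additive in the interval. The bound by the initial
    error is uniform in the interval, unlike the rate of decay. *)
Lemma error_mass_decay a b : 0 <= a -> a < b ->
  (forall k, error_mass k a b <= error_mass 0 a b) /\
  error_mass k a b @[k --> \oo] --> (0 : R).
Proof.
move=> + ab; move: a b ab.
apply: (@atom_ind _ _ _ _ EA A_dense A_discrete (fun a b => 0 <= a ->
  (forall k, error_mass k a b <= error_mass 0 a b) /\
  error_mass k a b @[k --> \oo] --> (0 : R))).
  move=> a b c ab bc Qab Qbc a0.
  have [le1 c1] := Qab a0; have [le2 c2] := Qbc (le_trans a0 (ltW ab)).
  have e k : error_mass k a c = error_mass k a b + error_mass k b c.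
    by rewrite /error_mass; ring.
  split; first by move=> k; rewrite !e lerD.
  have c3 : error_mass k a b + error_mass k b c @[k --> \oo] --> (0 + 0 : R).
    by apply: cvgD.
  by rewrite addr0 in c3; rewrite (eq_cvg _ _ e).
move=> a s b abs a0; have ab := ltW (atom_lt abs).
have e k := error_mass_atom k a0 abs.
have m0 : 0 <= error_mass 0 a b by rewrite subr_ge0 sf_distr_nondecreasing.
have q0 : 0 <= cos (s * T) ^+ 2 by exact: sqr_ge0.
have q1 : cos (s * T) ^+ 2 <= 1 by rewrite cos2sin2 gerBl sqr_ge0.
split.
  move=> k; rewrite e ler_piMl//; apply: exprn_ile1; first exact: exprn_ge0.
  exact: exprn_ile1.
rewrite (eq_cvg _ _ e).
have [P0|P0] := eqVneq (P a b (iteration_error 0)) 0.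
  rewrite /error_mass -sqr_norm_spec_proj// P0 normr0 expr0n/=.
  by under eq_fun do rewrite mulr0; exact: cvg_cst.
have c0 : ((cos (s * T) ^+ 2) ^+ 2) ^+ k * error_mass 0 a b @[k --> \oo] -->
    0 * error_mass 0 a b.
  apply: cvgMr_tmp; apply: cvg_expr; rewrite ger0_norm ?sqr_ge0//.
  by rewrite exprn_ilt1// (atom_cos_lt1 abs P0).
by rewrite mul0r in c0.
Qed.

(** Cut at a frequency N beyond which the initial error has mass at most
    e / 2. This remains true of all later errors, and below N the mass tends to
    0. *)
Lemma iteration_error_cvg0 : iteration_error k @[k --> \oo] --> (0 : H).
Proof.
pose chi := iteration_error.
have d0 x : sf_distr E x 0 = 0.
  exact: (sf_distr_nonpos EA A_dense A_discrete A_positive).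
suff sq : `|chi k| ^+ 2 @[k --> \oo] --> (0 : R).
  apply/cvgrPdist_le => e e0.
  move/cvgrPdist_le: sq => /(_ _ (exprn_gt0 2 e0)); apply: filterS => k.
  rewrite !sub0r !normrN ger0_norm ?sqr_ge0//.
  by rewrite ler_pXn2r ?nnegrE// ltW.
apply/cvgrPdist_le => e e0; have e2 : 0 < e / 2 by rewrite divr_gt0.
have := @cvg_comp _ _ _ _ _ _ _ _ (@cvgr_idn R) (@sf_distr_cvgy _ _ E (chi 0)).
rewrite -(cvg_shiftS (fun n => sf_distr E (chi 0) n%:R)).
move=> /cvgrPdist_le/(_ _ e2)[N _ /(_ N (leqnn N))/= hN].
have [_ cN] := error_mass_decay (lexx 0) (ltr0Sn R N).
move/cvgrPdist_le: cN => /(_ _ e2); apply: filterS => k.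
rewrite !sub0r !normrN ger0_norm; last first.
  by rewrite subr_ge0 sf_distr_nondecreasing.
rewrite ger0_norm ?sqr_ge0// => hk.
have cM : sf_distr E (chi k) M @[M --> +oo] --> `|chi k| ^+ 2.
  exact: sf_distr_cvgy.
apply: (ler_cvg_to cM (cvg_cst e)).
near=> M; have NM : N.+1%:R < M by near: M; exact: nbhs_pinfty_gt.
have [leM _] := error_mass_decay (ler0n R N.+1) NM.
have := leM k; have := sf_distr_le E (chi 0) M.
move: hN hk; rewrite /error_mass -!/(chi _) d0 => /(le_trans (ler_norm _)).
lra.
Unshelve. all: by end_near. Qed.

Lemma iteration_cvg :
  iter k (iteration_map E A T (u 0) (u T)) phi0 @[k --> \oo] -->
  time_derive T u 0.
Proof.
rewrite -[X in _ --> X]add0r.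
under eq_fun do rewrite -(subrK (time_derive T u 0) (iter _ _ _)).
by apply: cvgD; [exact: iteration_error_cvg0|exact: cvg_cst].
Qed.

End iteration.
End wave.

Theorem theorem7 (R : realType) (n : nat) (Omega : set 'rV[R]_n)
    (Omega_open : open Omega) (Omega_bounded : bounded_set Omega)
    (Omega_smooth : smooth_boundary Omega)
    (A : operator (L2_domain Omega_open))
    (A_unbounded : op_unbounded A) (A_self_adjoint : self_adjoint A)
    (A_positive : op_positive A) (A_discrete : discrete_spectrum A)
    (E : spectral_family (L2_domain Omega_open)) (EA : resolution_of E A)
    (T : R) (T_gt0 : 0 < T)
    (T_nonresonant : forall k : nat, (0 < k)%N ->
      ~ op_eigenvalue A (k%:R * pi / T))
    (f g phi0 : L2_domain Omega_open)
    (f_H1 : sobolev E 1 f) (g_H1 : sobolev E 1 g)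
    (u : R -> L2_domain Omega_open) (u_Vh : wave_solution E A T u)
    (u0 : u 0 = f) (uT : u T = g) :
  iter k (iteration_map E A T f g) phi0 @[k --> \oo] --> time_derive T u 0.
Proof.
rewrite -u0 -uT; apply: (iteration_cvg EA) => //.
exact: L2_complete.
Qed.
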